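(* Let $K \subset \mathbb{R}^k$ and $L \subset \mathbb{R}^l$ be Hanner polytopes, and let $Q^1 = (q_1^1, \ldots, q_{2k}^1)$ with momenta $p_1^1 \rightarrow \ldots \rightarrow p_{2k}^1\to p_1^1$ and $Q^2 = (q_1^2, \ldots, q_{2l}^2)$ with momenta $p_1^2 \rightarrow \ldots \rightarrow p_{2l}^2\to p_1^2$ be simple classical closed billiard trajectories in the configurations $K \times K^{\circ}$ and $L \times L^{\circ}$ respectively. Consider the Hanner polytope $H = K \oplus_1 L\subset\mathbb{R}^{k+l}$ (the first $k$ coordinates correspond to $K$ and the last $l$ coordinates to $L$) with its polar $H^{\circ} = K^{\circ} \oplus_{\infty} L^{\circ}$. For $\alpha,\beta\in(0,1)$ take the initial coordinate $q_1 = (\alpha q_1^1, (1-\alpha) q_1^2)$ and the initial momentum $p_1 = (\beta p_1^1 + (1-\beta)p_2^1,\ p_1^2)$. Then for any $\alpha \in (0,1)$ and for almost any $\beta \in (0,1)$, the extension of this initial position $(q_1,p_1)$ according to the billiard rules in $H \times H^{\circ}$ gives a simple classical closed billiard trajectory such that: (1) the projection of its coordinate polygonal line to the first $k$ coordinates is congruent to $\alpha Q^1$, and its projection to the last $l$ coordinates is congruent to $(1-\alpha) Q^2$; (2) the projection of its momentum polygonal line to the first $k$ coordinates coincides with the momentum polygonal line of $Q^1$, and its projection to the last $l$ coordinates coincides with the momentum polygonal line of $Q^2$.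
   Context: Hanner polytopes. If $K\subset\mathbb{R}^k$, $L\subset\mathbb{R}^l$ are unit balls of norms $\|\cdot\|^{(1)},\|\cdot\|^{(2)}$, then $K\oplus_1L\subset\mathbb{R}^{k+l}$ is the unit ball of the norm $\|x\|^{(1)}+\|y\|^{(2)}$, and $K\oplus_\infty L\subset\mathbb{R}^{k+l}$ is the unit ball of $\max\{\|x\|^{(1)},\|y\|^{(2)}\}$, for $(x,y)\in\mathbb{R}^k\oplus\mathbb{R}^l$. Hanner polytopes are the bodies obtained inductively: $[-1,1]\subset\mathbb{R}^1$ is a Hanner polytope, and if $K,L$ are Hanner polytopes, so are $K\oplus_1L$ and $K\oplus_\infty L$. Classical billiard trajectories. Let $V=\mathbb{R}^n$ with dual $V^*$, and let $K\subset V$, $T\subset V^*$ be convex polytopes containing the origin in their interiors. For $q$ in the relative interior of a facet of $K$ (the smooth part of $\partial K$), $n_K(q)\in V^*$ is the outer normal given by the differential at $q$ of the gauge function of $K$ (the norm with unit ball $K$); similarly $n_T(p)\in V$ for $p$ in the relative interior of a facet of $T$. A classical closed billiard trajectory in $K$ with geometry specified by $T$ (in the configuration $K\times T$) is a cyclic sequence of bounce points $q_1,\dots,q_m$ and momenta $p_1,\dots,p_m$ (indices modulo $m$), each $q_i$ in the relative interior of a facet of $K$ and each $p_i$ in the relative interior of a facet of $T$, such that for all $i$ $$p_{i+1}-p_i=-\lambda_i\, n_K(q_i),\qquad q_{i+1}-q_i=\mu_i\, n_T(p_{i+1}),\qquad \lambda_i,\mu_i>0.$$ It is then called $m$-periodic.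 (In dimension $1$, facets are the two end points, which count as their own relative interiors.) It is simple if it does not traverse the same closed route several times, i.e. the cyclic sequence $((q_i,p_i))_i$ is not a repetition, two or more times, of a shorter one. Every simple classical closed billiard trajectory in $K\times K^\circ$ for a Hanner polytope $K\subset\mathbb{R}^k$ is $2k$-periodic, which is why $Q^1,Q^2$ have $2k$ and $2l$ vertices. Extending $(q_1,p_1)$ according to the billiard rules means successively determining $p_2=p_1-\lambda n_H(q_1)\in\partial H^\circ$ with $\lambda>0$, $q_2=q_1+\mu n_{H^\circ}(p_2)\in\partial H$ with $\mu>0$, and so on. The coordinate (momentum) polygonal line of a trajectory is the closed polygonal line with successive vertices $q_i$ (respectively $p_i$); projections of polygonal lines are understood as closed polygonal lines, where repeated consecutive vertices and vertices lying inside a segment between their neighbours are disregarded. ''Almost any'' refers to Lebesgue measure. *)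

(* Defs.v *)
From HB Require Import structures.
From mathcomp Require Import all_boot all_order all_algebra.
From mathcomp Require Import all_classical all_reals all_analysis.

Set Implicit Arguments.
Unset Strict Implicit.
Unset Printing Implicit Defensive.
Import Order.TTheory GRing.Theory Num.Theory.
Import numFieldNormedType.Exports.

Local Open Scope classical_set_scope.
Local Open Scope ring_scope.

(* R^n is 'rV[R]_n and its dual is identified with 'rV[R]_n through dotp. The
   library norm on 'rV[R]_n is the sup norm; it is used only for its topology,
   and Euclidean lengths are expressed with dotp. *)
Section ConvexBodies.
Variables (R : realType) (n : nat).
Implicit Types (A F K : set 'rV[R]_n) (x y p q : 'rV[R]_n).

Definition dotp x y : R := (x *m y^T) 0 0.

Definition gauge_fun K x : R :=
  inf [set t : R | 0 < t /\ exists2 y, K y & x = t *: y].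

Definition polar K : set 'rV[R]_n :=
  [set p | forall q, K q -> dotp p q <= 1].

Definition boundary A : set 'rV[R]_n := closure A `\` interior A.

Definition aff_hull A : set 'rV[R]_n :=
  [set x | exists m (P : 'M[R]_(m, n)) (c : 'rV[R]_m),
    [/\ forall i, A (row i P), \sum_i c 0 i = 1 & x = c *m P]].

Definition relint A : set 'rV[R]_n :=
  [set x | A x /\ within (aff_hull A) (nbhs x) A].

(* The last condition says that the face F has dimension n - 1. *)
Definition facet K F : Prop :=
  exists a b, [/\ a != 0, forall x, K x -> dotp a x <= b,
    F = K `&` [set x | dotp a x = b] & aff_hull F = [set x | dotp a x = b]].

Definition smooth_point K x : Prop := exists2 F, facet K F & relint F x.

(* The covector representing the differential of the gauge function at x. *)
Definition outer_normal K x : 'rV[R]_n :=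
  \row_j 'd (gauge_fun K : 'rV[R]_n -> R) x (delta_mx 0 j).

End ConvexBodies.

Section HannerPolytopes.
Variable R : realType.

Definition sum1 k l (K : set 'rV[R]_k) (L : set 'rV[R]_l) :
    set 'rV[R]_(k + l) :=
  [set z | gauge_fun K (lsubmx z) + gauge_fun L (rsubmx z) <= 1].

Definition sumoo k l (K : set 'rV[R]_k) (L : set 'rV[R]_l) :
    set 'rV[R]_(k + l) :=
  [set z | Num.max (gauge_fun K (lsubmx z)) (gauge_fun L (rsubmx z)) <= 1].

Inductive hanner : forall n, set 'rV[R]_n -> Prop :=
| hanner_segment : hanner [set x : 'rV[R]_1 | -1 <= x 0 0 <= 1]
| hanner_sum1 k l (K : set 'rV[R]_k) (L : set 'rV[R]_l) :
    hanner K -> hanner L -> hanner (sum1 K L)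
| hanner_sumoo k l (K : set 'rV[R]_k) (L : set 'rV[R]_l) :
    hanner K -> hanner L -> hanner (sumoo K L).

End HannerPolytopes.

(* A state (q, p) consists of a bounce point q and of the momentum p with which
   q is reached; the momentum p' of the next state (q', p') is the one after
   the bounce at q. *)
Section Billiards.
Variables (R : realType) (n : nat) (K T : set 'rV[R]_n).
Implicit Types (p q : 'rV[R]_n) (s : seq ('rV[R]_n * 'rV[R]_n)).

Definition momentum_rule q p p' : Prop :=
  exists2 lam : R, 0 < lam & p' - p = - (lam *: outer_normal K q).

Definition position_rule q p' q' : Prop :=
  exists2 mu : R, 0 < mu & q' - q = mu *: outer_normal T p'.

Definition closed_billiard s : Prop :=
  [/\ s != [::],
      forall z, z \in s -> smooth_point K z.1 /\ smooth_point T z.2 &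
      cycle (fun z z' => `[< momentum_rule z.1 z.2 z'.2 /\
                             position_rule z.1 z'.2 z'.1 >]) s].

(* The infinite sequence of states determined by its first one: the normals
   involved exist, and each new momentum and bounce point is the only one
   allowed by the rules. *)
Definition billiard_extension (z : nat -> 'rV[R]_n * 'rV[R]_n) : Prop :=
  forall i,
  [/\ smooth_point K (z i).1,
      unique (fun p' => momentum_rule (z i).1 (z i).2 p' /\ boundary T p')
             (z i.+1).2,
      smooth_point T (z i.+1).2 &
      unique (fun q' => position_rule (z i).1 (z i.+1).2 q' /\ boundary K q')
             (z i.+1).1].

End Billiards.

Definition simple_cycle (T : Type) (s : seq T) : Prop :=
  ~ exists (t : seq T) (r : nat), (1 < r)%N /\ s = flatten (nseq r t).

Section ClosedPolygonalLines.
Variables (R : realType) (n : nat).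
Implicit Types (s t : seq 'rV[R]_n) (u v w : 'rV[R]_n).

(* Equality of oriented closed polygonal lines given by cyclic sequences of
   vertices, disregarding repeated consecutive vertices and vertices lying in
   the segment between their neighbours. *)
Inductive same_closed_line : seq 'rV[R]_n -> seq 'rV[R]_n -> Prop :=
| scl_refl s : same_closed_line s s
| scl_sym s t : same_closed_line s t -> same_closed_line t s
| scl_trans s t r :
    same_closed_line s t -> same_closed_line t r -> same_closed_line s r
| scl_rot i s : same_closed_line s (rot i s)
| scl_repeat u s : same_closed_line (u :: u :: s) (u :: s)
| scl_inside u v w s (c : R) : 0 <= c <= 1 -> v = (1 - c) *: u + c *: w ->
    same_closed_line (u :: v :: w :: s) (u :: w :: s).

Definition euclidean_isometry (g : 'rV[R]_n -> 'rV[R]_n) : Prop :=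
  forall x y, dotp (g x - g y) (g x - g y) = dotp (x - y) (x - y).

Definition congruent_closed_line s t : Prop :=
  exists2 g, euclidean_isometry g & same_closed_line (map g s) t.

End ClosedPolygonalLines.

(* Main.v *)
(* A Hanner polytope and its polar are the unit balls of a pair of dual norms N, M
   built from |x| by sums and maxima, and the smooth boundary points are those
   near which the norm is affine. By induction, the normals a at a smooth point of
   K and b at a smooth point of its polar satisfy <a, b> = 1 or -1, so that the
   momentum runs through the interior of the polar between two bounces.

   In the sum of two configurations the momentum moves by -t (a1, a2) until its
   first component to reach the boundary selects the component of the position
   which moves; both components thus keep following trajectories of the factors,
   with a common clock t. For a closed trajectory with m bounces in dimension n
   the total time T satisfies n T = 2 m: this passes from the factors to their
   sum, since T is common and the bounces add up, and to the polar, since the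
   lengths of the position and of the momentum lines agree. A trajectory with 2n
   bounces has therefore T = 4, in both factors, so the combined motion closes up
   after 2k + 2l bounces. Only countably many values of beta make the two
   components hit the boundary simultaneously. *)
Require Import Defs.
From HB Require Import structures.
From mathcomp Require Import all_boot all_order all_algebra.
From mathcomp Require Import all_classical all_reals all_analysis.
From mathcomp Require Import ring lra.

Set Implicit Arguments.
Unset Strict Implicit.
Unset Printing Implicit Defensive.
Import Order.TTheory GRing.Theory Num.Theory.
Import numFieldNormedType.Exports.

Local Open Scope classical_set_scope.
Local Open Scope ring_scope.

(** * Norms and their smooth points *)

Section Dotp.
Variables (R : realType).

Lemma dotpE n (x y : 'rV[R]_n) : dotp x y = \sum_i x 0 i * y 0 i.
Proof. by rewrite /dotp mxE; apply: eq_bigr => i _; rewrite mxE. Qed.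

Lemma dotpC n (x y : 'rV[R]_n) : dotp x y = dotp y x.
Proof. by rewrite !dotpE; apply: eq_bigr => i _; rewrite mulrC. Qed.

Lemma dotpDr n (x y z : 'rV[R]_n) : dotp x (y + z) = dotp x y + dotp x z.
Proof. by rewrite /dotp linearD mulmxDr mxE. Qed.

Lemma dotpDl n (x y z : 'rV[R]_n) : dotp (y + z) x = dotp y x + dotp z x.
Proof. by rewrite !(dotpC _ x) dotpDr. Qed.

Lemma dotpZr n c (x y : 'rV[R]_n) : dotp x (c *: y) = c * dotp x y.
Proof. by rewrite /dotp linearZ -scalemxAr mxE. Qed.

Lemma dotpZl n c (x y : 'rV[R]_n) : dotp (c *: x) y = c * dotp x y.
Proof. by rewrite !(dotpC _ y) dotpZr. Qed.

Lemma dotpNr n (x y : 'rV[R]_n) : dotp x (- y) = - dotp x y.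
Proof. by rewrite -scaleN1r dotpZr mulN1r. Qed.

Lemma dotpNl n (x y : 'rV[R]_n) : dotp (- x) y = - dotp x y.
Proof. by rewrite -scaleN1r dotpZl mulN1r. Qed.

Lemma dotp0r n (x : 'rV[R]_n) : dotp x 0 = 0.
Proof. by rewrite -(scale0r x) dotpZr mul0r. Qed.

Lemma dotp0l n (x : 'rV[R]_n) : dotp 0 x = 0.
Proof. by rewrite dotpC dotp0r. Qed.

Lemma dotp_row k l (x : 'rV[R]_k) (y : 'rV[R]_l) (z : 'rV[R]_(k + l)) :
  dotp (row_mx x y) z = dotp x (lsubmx z) + dotp y (rsubmx z).
Proof.
by rewrite /dotp -{1}(hsubmxK z) tr_row_mx mul_row_col mxE.
Qed.

Lemma dotp_sub k l (c z : 'rV[R]_(k + l)) :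
  dotp c z = dotp (lsubmx c) (lsubmx z) + dotp (rsubmx c) (rsubmx z).
Proof. by rewrite -dotp_row hsubmxK. Qed.

Lemma dotp_gt0 n (x : 'rV[R]_n) : x != 0 -> 0 < dotp x x.
Proof.
move=> x0; rewrite dotpE lt0r sumr_ge0 ?andbT; last first.
  by move=> i _; rewrite -expr2 sqr_ge0.
apply: contra x0; rewrite psumr_eq0; last by move=> i _; rewrite -expr2 sqr_ge0.
move/allP => h; apply/eqP/rowP => i; rewrite mxE.
by have := h i (mem_index_enum _); rewrite /= mulf_eq0 orbb => /eqP.
Qed.

End Dotp.

Section Norms.
Variable R : realType.

(* The last two conditions are stable under sums and maxima and make the topology
   of the norm that of 'rV[R]_n. *)
Record is_norm n (N : 'rV[R]_n -> R) : Prop := IsNorm {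
  normD : forall x y : 'rV[R]_n, N (x + y) <= N x + N y;
  normZ : forall t (x : 'rV[R]_n), N (t *: x) = `|t| * N x;
  norm_ge_coord : forall (x : 'rV[R]_n) j, `|x 0 j| <= N x;
  norm_le_sum : forall x : 'rV[R]_n, N x <= \sum_j `|x 0 j| }.

Definition sumN k l (N1 : 'rV[R]_k -> R) (N2 : 'rV[R]_l -> R) z :=
  N1 (lsubmx z) + N2 (rsubmx z).
Definition maxN k l (N1 : 'rV[R]_k -> R) (N2 : 'rV[R]_l -> R) z :=
  Num.max (N1 (lsubmx z)) (N2 (rsubmx z)).

Section OneNorm.
Variables (n : nat) (N : 'rV[R]_n -> R).
Hypothesis hN : is_norm N.

Lemma norm_zero : N 0 = 0.
Proof. by rewrite -(scale0r 0) (normZ hN) // normr0 mul0r. Qed.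

Lemma normNv x : N (- x) = N x.
Proof. by rewrite -scaleN1r (normZ hN) // normrN1 mul1r. Qed.

Lemma normv_ge0 x : 0 <= N x.
Proof.
have := normD hN x (- x); rewrite subrr norm_zero normNv => h; lra.
Qed.

Lemma normv_eq0 x : N x = 0 -> x = 0.
Proof.
move=> x0; apply/rowP => j; rewrite mxE; apply/eqP.
by rewrite -normr_le0 -x0 norm_ge_coord.
Qed.

Lemma normv_gt0 x : x != 0 -> 0 < N x.
Proof.
by move=> x0; rewrite lt0r normv_ge0 andbT; apply: contra x0 => /eqP/normv_eq0->.
Qed.

Lemma norm_convex x y t : 0 <= t <= 1 ->
  N ((1 - t) *: x + t *: y) <= (1 - t) * N x + t * N y.
Proof.
move=> /andP[t0 t1]; apply: le_trans (normD hN _ _) _.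
by rewrite !(normZ hN) // !ger0_norm // subr_ge0.
Qed.

(** The norm lies between the sup norm and the sum of the coordinates, so its balls form a
    neighbourhood basis. *)
Lemma norm_nbhsP (x : 'rV[R]_n) (A : set 'rV[R]_n) :
  nbhs x A <-> exists2 e, 0 < e & forall y, N (y - x) < e -> A y.
Proof.
rewrite -nbhs_ballE; split.
  move=> [e /= e0 h]; exists e => // y hy; apply: h; split => // i j.
  rewrite /ball /= distrC (le_lt_trans _ hy) //.
  by rewrite (ord1 i) (le_trans _ (norm_ge_coord hN _ j)) // !mxE.
move=> [e e0 h]; exists (e / n.+1%:R) => /=; first by rewrite divr_gt0.
move=> y [_ hy]; apply: h.
apply: (le_lt_trans (norm_le_sum hN _)).
have : \sum_(j < n) `|(y - x) 0 j| <= \sum_(j < n) (e / n.+1%:R).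
  apply: ler_sum => j _; have /= := hy 0 j.
  by rewrite /ball /= distrC !mxE => /ltW.
rewrite sumr_const card_ord => /le_lt_trans; apply.
by rewrite -[_ *+ n]mulr_natr -mulrA gtr_pMr // mulrC ltr_pdivrMr // mul1r ltr_nat.
Qed.

(** The gauge is the infimum of the positive [t >= N x]; at [x = 0] it is not attained, hence the
    argument with [e]. *)
Lemma gauge_ball : gauge_fun [set x | N x <= 1] = N.
Proof.
apply/funext => x; rewrite /gauge_fun.
set A := [set _ | _].
have AE : forall t, A t <-> 0 < t /\ N x <= t.
  move=> t; split=> [[t0 [y /= hy ->]]|[t0 h]]; split => //.
    by rewrite (normZ hN) // gtr0_norm // ger_pMr.
  exists (t^-1 *: x) => /=; last by rewrite scalerA divff ?scale1r ?gt_eqF.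
  by rewrite (normZ hN) // gtr0_norm ?invr_gt0 // ler_pdivrMl // mulr1.
have lbA : has_inf A.
  split; first by exists (N x + 1); apply/AE; have := normv_ge0 x; split; lra.
  by exists 0 => t /AE[/ltW].
apply/eqP; rewrite eq_le; apply/andP; split; last first.
  by apply: lb_le_inf; [exact: lbA.1 | move=> t /AE[]].
apply/ler_addgt0Pr => e e0; apply: ge_inf; first exact: lbA.2.
by apply/AE; have := normv_ge0 x; split; lra.
Qed.

(* The neighbourhood of [x] is a ball of [N] itself, so that slopes can be
   computed for sums and maxima without any topology. *)
Definition locally_affine x a : Prop :=
  exists2 e, 0 < e & forall h, N h < e -> N (x + h) = N x + dotp a h.

Lemma small_scale e (v : 'rV[R]_n) : 0 < e ->
  exists2 t, 0 < t <= 1 & N (t *: v) < e.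
Proof.
move=> e0; exists (e / (e + N v + 1)).
  have v0 := normv_ge0 v.
  have d0 : 0 < e + N v + 1 by lra.
  by rewrite divr_gt0 //= ler_pdivrMr // mul1r; lra.
have v0 := normv_ge0 v.
have d0 : 0 < e + N v + 1 by lra.
rewrite (normZ hN) // ger0_norm ?divr_ge0 // ?ltW //.
rewrite mulrAC ltr_pdivrMr // ltr_pM2l //; lra.
Qed.

(** Euler's identity: move along [x] itself, where the norm is homogeneous. *)
Lemma laff_dot x a : locally_affine x a -> dotp a x = N x.
Proof.
case=> e e0 h; have [t /andP[t0 _] ht] := small_scale x e0.
have := h _ ht; rewrite -{1}(scale1r x) -scalerDl (normZ hN) // gtr0_norm; last lra.
rewrite dotpZr mulrDl mul1r => /addrI /(mulfI (lt0r_neq0 t0)) //.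
Qed.

(** The slope is a subgradient: compare the expansion at a short step along [y] with the triangle
    inequality. *)
Lemma laff_le x a y : locally_affine x a -> dotp a y <= N y.
Proof.
case=> e e0 h; have [t /andP[t0 _] ht] := small_scale y e0.
have := normD hN x (t *: y).
by rewrite h // (normZ hN) // gtr0_norm // dotpZr lerD2l ler_pM2l.
Qed.

Lemma laff_opp x a : locally_affine x a -> locally_affine (- x) (- a).
Proof.
case=> e e0 h; exists e => // v hv.
rewrite -normNv opprD opprK h ?normNv //.
by rewrite dotpNl dotpNr.
Qed.

Lemma laff_scale c x a : 0 < c -> locally_affine x a -> locally_affine (c *: x) a.
Proof.
move=> c0 [e e0 h]; exists (c * e); first exact: mulr_gt0.
move=> v hv; have -> : c *: x + v = c *: (x + c^-1 *: v).
  by rewrite scalerDr scalerA divff ?scale1r // gt_eqF.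
rewrite (normZ hN) // h; last first.
  by rewrite (normZ hN) // gtr0_norm ?invr_gt0 // ltr_pdivrMl.
rewrite mulrDr (normZ hN) // gtr0_norm // dotpZr mulrA divff ?mul1r // gt_eqF //.
Qed.

Lemma laff_unique x a b : locally_affine x a -> locally_affine x b -> a = b.
Proof.
case=> e e0 h [d d0 g]; apply/eqP; rewrite -subr_eq0; apply/negPn/negP => ab.
have m0 : 0 < Num.min e d by rewrite lt_min e0.
have [t /andP[t0 _]] := small_scale (a - b) m0.
rewrite lt_min => /andP[te td].
have := h _ te; rewrite g // !dotpZr => /addrI /(mulfI (lt0r_neq0 t0)) /eqP.
rewrite eq_sym -subr_eq0 -dotpNl -dotpDl; apply/negP.
by rewrite gt_eqF // dotp_gt0.
Qed.

(** An expansion at [0] would make the norm odd near [0], while it is even and positive on a nonzero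
    vector. *)
Lemma laff_neq0 x a : (0 < n)%N -> locally_affine x a -> x != 0.
Proof.
move=> n0 [e e0 h]; apply/negP => /eqP x0.
have v0 : const_mx 1 != 0 :> 'rV[R]_n.
  apply/eqP => /rowP /(_ (Ordinal n0)); rewrite !mxE => /eqP.
  by rewrite oner_eq0.
have [t /andP[t0 _] ht] := small_scale (const_mx 1) e0.
have g := h _ ht; have := h (- (t *: const_mx 1)); rewrite normNv => /(_ ht).
move: g; rewrite x0 !add0r norm_zero !add0r normNv => ->.
rewrite dotpNr; have := h _ ht; rewrite x0 add0r norm_zero add0r => <-.
have := normv_gt0 v0; rewrite (normZ hN) // gtr0_norm // => p.
have : 0 < t * N (const_mx 1) by apply: mulr_gt0.
by move=> ?; lra.
Qed.

(** On the ray the norm is convex and starts at 1 with nonzero slope, so it takes the value 1 at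
    most once more. This makes the next momentum and the next bounce point unique. *)
Lemma laff_inj_ray u v b s s' : N u = 1 -> locally_affine u b ->
  dotp b v != 0 -> 0 < s -> 0 < s' -> N (u + s *: v) = 1 ->
  N (u + s' *: v) = 1 -> s = s'.
Proof.
move=> u1 ub bv.
have wl : forall s s', 0 < s -> s < s' -> N (u + s *: v) = 1 ->
    N (u + s' *: v) = 1 -> False.
  move=> {}s {}s' s0 ss' Ns Ns'.
  have s'0 : 0 < s' by lra.
  have [e e0 h] := ub; have [t /andP[t0 t1] ht] := small_scale (s *: v) e0.
  have cvx : forall r r' c, 0 <= c <= 1 -> N (u + r *: v) <= 1 ->
    N (u + r' *: v) <= 1 ->
    N (u + ((1 - c) * r + c * r') *: v) <=
      (1 - c) * N (u + r *: v) + c * N (u + r' *: v).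
    move=> r r' c c01 _ _; apply: le_trans (norm_convex _ _ c01).
    rewrite le_eqVlt; apply/orP; left; apply/eqP; congr N.
    by apply/rowP => j; rewrite !mxE; ring.
  have u0 : N (u + 0 *: v) = 1 by rewrite scale0r addr0.
  have Nt : N (u + (t * s) *: v) = 1 + t * s * dotp b v.
    by rewrite -scalerA h // !dotpZr u1 mulrA.
  have ts0 : 0 < t * s by apply: mulr_gt0.
  (* Convexity up to [s'] gives at most 1, and the nonzero slope at the start excludes equality. *)
  have lt1 : N (u + (t * s) *: v) < 1.
    have : N (u + (t * s) *: v) <= 1.
      have tss : t * s <= s' by apply: le_trans (ltW ss'); rewrite ger_pMl.
      have c01 : 0 <= t * s / s' <= 1.
        by rewrite divr_ge0 ?(ltW ts0) ?(ltW s'0) //= ler_pdivrMr // mul1r.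
      have := cvx 0 s' (t * s / s') c01; rewrite u0 Ns' lexx => /(_ isT isT).
      by rewrite mulr0 add0r !mulr1 subrK divfK // gt_eqF.
    rewrite le_eqVlt => /orP[|//]; rewrite Nt => /eqP/eqP.
    rewrite -subr_eq0 addrAC subrr add0r !mulf_eq0 (negbTE bv) orbF.
    by rewrite !gt_eqF.
  (* [s] is the combination of [t * s] and [s'] with weight [c < 1], so the norm at [s] would be
     below 1. *)
  pose c := (s - t * s) / (s' - t * s).
  have tss : t * s <= s by rewrite ger_pMl.
  have d0 : 0 < s' - t * s by lra.
  have c0 : 0 <= c by rewrite /c divr_ge0 //; lra.
  have c1 : c < 1 by rewrite /c ltr_pdivrMr //; lra.
  have := cvx (t * s) s' c; rewrite c0 (ltW c1) Ns' lexx (ltW lt1).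
  move=> /(_ isT isT isT).
  have -> : (1 - c) * (t * s) + c * s' = s.
    have : c * (s' - t * s) = s - t * s by rewrite /c divfK // gt_eqF.
    by move=> H; transitivity (t * s + c * (s' - t * s)); [ring | rewrite H; ring].
  rewrite Ns mulr1 => H.
  have : (1 - c) * N (u + (t * s) *: v) < (1 - c) * 1 by rewrite ltr_pM2l // subr_gt0.
  by move=> ?; lra.
move=> s0 s'0 Ns Ns'; case: (ltgtP s s') => // hs; exfalso.
  exact: (wl s s').
exact: (wl s' s).
Qed.

Lemma laff_lt1_ray u v b s t : N u = 1 -> locally_affine u b ->
  dotp b v != 0 -> N (u + s *: v) = 1 -> 0 < t < s -> N (u + t *: v) < 1.
Proof.
move=> u1 ub bv Ns /andP[t0 ts]; rewrite lt_neqAle; apply/andP; split.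
  apply/negP => /eqP Nt; have s0 : 0 < s by lra.
  by have := laff_inj_ray u1 ub bv t0 s0 Nt Ns; lra.
have s0 : 0 < s by lra.
have -> : u + t *: v = (1 - t / s) *: u + (t / s) *: (u + s *: v).
  by apply/rowP => j; rewrite !mxE; field; rewrite gt_eqF.
apply: le_trans (norm_convex _ _ _) _; last by rewrite u1 Ns; lra.
by rewrite divr_ge0 /= ?(ltW t0) ?(ltW s0) // ler_pdivrMr // mul1r ltW.
Qed.

Lemma boundary_ball : boundary [set x | N x <= 1] = [set x | N x = 1].
Proof.
apply/seteqP; split=> x /=.
  move=> [cx ix]; apply/eqP; rewrite eq_le; apply/andP; split.
    rewrite leNgt; apply/negP => x1.
    have /cx [y [/= y1]] : nbhs x [set y | N (y - x) < N x - 1].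
      by apply/norm_nbhsP; exists (N x - 1) => //; lra.
    have := normD hN (x - y) y; rewrite subrK -(normNv (x - y)) opprB; lra.
  rewrite leNgt; apply/negP => x1; apply: ix; apply/norm_nbhsP.
  exists (1 - N x); first lra.
  by move=> y hy /=; have := normD hN (y - x) x; rewrite subrK; lra.
move=> x1; split; first by apply: subset_closure => /=; rewrite x1.
move=> /norm_nbhsP [e e0 h]; have [t /andP[t0 _] ht] := small_scale x e0.
have := h (x + t *: x); rewrite addrC addKr => /(_ ht) /=.
have -> : x + t *: x = (1 + t) *: x by rewrite scalerDl scale1r.
by rewrite (normZ hN) // x1 gtr0_norm; lra.
Qed.

End OneNorm.
End Norms.

(** * Smooth points of sums and maxima of norms *)

Section SumMax.
Variables (R : realType) (k l : nat).
Variables (N1 : 'rV[R]_k -> R) (N2 : 'rV[R]_l -> R).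
Hypotheses (h1 : is_norm N1) (h2 : is_norm N2).

Lemma lsubmxZ (t : R) (z : 'rV[R]_(k + l)) : lsubmx (t *: z) = t *: lsubmx z.
Proof. by apply/rowP => j; rewrite !mxE. Qed.

Lemma rsubmxZ (t : R) (z : 'rV[R]_(k + l)) : rsubmx (t *: z) = t *: rsubmx z.
Proof. by apply/rowP => j; rewrite !mxE. Qed.

Lemma lsubmxD (y z : 'rV[R]_(k + l)) : lsubmx (y + z) = lsubmx y + lsubmx z.
Proof. by apply/rowP => j; rewrite !mxE. Qed.

Lemma rsubmxD (y z : 'rV[R]_(k + l)) : rsubmx (y + z) = rsubmx y + rsubmx z.
Proof. by apply/rowP => j; rewrite !mxE. Qed.

Lemma is_norm_sum : is_norm (sumN N1 N2).
Proof.
split=> [x y|t x|x j|x]; rewrite /sumN.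
- rewrite lsubmxD rsubmxD addrACA.
  by apply: lerD; [exact: (normD h1)|exact: (normD h2)].
- by rewrite lsubmxZ rsubmxZ (normZ h1) (normZ h2) mulrDr.
- case: (split_ordP j) => i ->.
    apply: le_trans (_ : N1 (lsubmx x) <= _).
      by have := norm_ge_coord h1 (lsubmx x) i; rewrite mxE.
    by rewrite lerDl (normv_ge0 h2).
  apply: le_trans (_ : N2 (rsubmx x) <= _).
    by have := norm_ge_coord h2 (rsubmx x) i; rewrite mxE.
  by rewrite lerDr (normv_ge0 h1).
- rewrite big_split_ord; apply: lerD.
    apply: le_trans (norm_le_sum h1 _) _.
    by apply: ler_sum => i _; rewrite mxE.
  apply: le_trans (norm_le_sum h2 _) _.
  by apply: ler_sum => i _; rewrite mxE.
Qed.

Lemma is_norm_max : is_norm (maxN N1 N2).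
Proof.
have le_sum z : maxN N1 N2 z <= sumN N1 N2 z.
  rewrite /maxN /sumN ge_max lerDl lerDr (normv_ge0 h1) (normv_ge0 h2) //.
split=> [x y|t x|x j|x]; last first.
- exact: le_trans (le_sum _) (norm_le_sum is_norm_sum _).
- rewrite /maxN le_max; apply/orP; case: (split_ordP j) => i ->; [left|right].
    by have := norm_ge_coord h1 (lsubmx x) i; rewrite mxE.
  by have := norm_ge_coord h2 (rsubmx x) i; rewrite mxE.
- by rewrite /maxN lsubmxZ rsubmxZ (normZ h1) (normZ h2) maxr_pMr.
- rewrite /maxN lsubmxD rsubmxD ge_max; apply/andP; split.
    apply: le_trans (normD h1 _ _) _.
    by apply: lerD; rewrite le_max lexx.
  apply: le_trans (normD h2 _ _) _.
  by apply: lerD; rewrite le_max lexx orbT.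
Qed.

Lemma laff_sum z c : locally_affine (sumN N1 N2) z c <->
  locally_affine N1 (lsubmx z) (lsubmx c) /\
  locally_affine N2 (rsubmx z) (rsubmx c).
Proof.
split.
  move=> [e e0 h]; split; exists e => // v hv.
    have := h (row_mx v 0).
    rewrite /sumN !lsubmxD !rsubmxD dotp_sub !row_mxKl !row_mxKr.
    rewrite (norm_zero h2) !addr0 dotp0r addr0 => /(_ hv).
    by rewrite addrAC => /addIr.
  have := h (row_mx 0 v).
  rewrite /sumN !lsubmxD !rsubmxD dotp_sub !row_mxKl !row_mxKr.
  rewrite (norm_zero h1) !add0r !addr0 dotp0r add0r => /(_ hv).
  by rewrite -addrA => /addrI.
move=> [[e e0 h] [d d0 g]]; exists (Num.min e d); first by rewrite lt_min e0.
move=> v; rewrite /sumN lt_min => /andP[ve vd].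
have v1 := normv_ge0 h1 (lsubmx v); have v2 := normv_ge0 h2 (rsubmx v).
rewrite lsubmxD rsubmxD h; last lra.
by rewrite g ?dotp_sub; [ring | lra].
Qed.

Lemma laff_maxl z a : N2 (rsubmx z) < N1 (lsubmx z) ->
  locally_affine N1 (lsubmx z) a -> locally_affine (maxN N1 N2) z (row_mx a 0).
Proof.
move=> lt [e e0 h].
(* [d] is half the gap: perturbing each block by less than [d] keeps the first norm the larger
   one. *)
pose d := (N1 (lsubmx z) - N2 (rsubmx z)) / 2.
have d0 : 0 < d by rewrite /d; lra.
exists (Num.min e d); first by rewrite lt_min e0.
move=> v; rewrite /maxN lt_min !gt_max => /andP[/andP[v1e v2e] /andP[v1d v2d]].
rewrite lsubmxD rsubmxD dotp_row dotp0l addr0.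
rewrite [in RHS]max_l ?(ltW lt) // -h // max_l //.
have := normD h2 (rsubmx z) (rsubmx v).
have := normD h1 (lsubmx z + lsubmx v) (- lsubmx v).
rewrite addrK (normNv h1).
by move: v1d v2d; rewrite /d; lra.
Qed.

Lemma laff_maxr z a : N1 (lsubmx z) < N2 (rsubmx z) ->
  locally_affine N2 (rsubmx z) a -> locally_affine (maxN N1 N2) z (row_mx 0 a).
Proof.
move=> lt [e e0 h].
pose d := (N2 (rsubmx z) - N1 (lsubmx z)) / 2.
have d0 : 0 < d by rewrite /d; lra.
exists (Num.min e d); first by rewrite lt_min e0.
move=> v; rewrite /maxN lt_min !gt_max => /andP[/andP[v1e v2e] /andP[v1d v2d]].
rewrite lsubmxD rsubmxD dotp_row dotp0l add0r.
rewrite [in RHS]max_r ?(ltW lt) // -h // max_r //.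
have := normD h1 (lsubmx z) (lsubmx v).
have := normD h2 (rsubmx z + rsubmx v) (- rsubmx v).
rewrite addrK (normNv h2).
by move: v1d v2d; rewrite /d; lra.
Qed.

(** At a nonzero tie, scaling the left block by [1 + t] raises the maximum while [1 - t] leaves it
    unchanged, which no affine function does. Without a tie the dominated block does not influence
    the maximum locally, so its slope vanishes. *)
Lemma laff_max z c : (0 < k + l)%N -> locally_affine (maxN N1 N2) z c ->
  (N2 (rsubmx z) < N1 (lsubmx z) /\
     exists2 a, locally_affine N1 (lsubmx z) a & c = row_mx a 0) \/
  (N1 (lsubmx z) < N2 (rsubmx z) /\
     exists2 a, locally_affine N2 (rsubmx z) a & c = row_mx 0 a).
Proof.
move=> kl hc; have [e e0 h] := hc.
have z0 : z != 0 by apply: laff_neq0 hc => //; exact: is_norm_max.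
(* A slope that leaves the maximum constant vanishes: test it on a small multiple of itself. *)
have sm k' (N : 'rV[R]_k' -> R) (hN : is_norm N) x y a d : N x < y -> 0 < d ->
    (forall v, N v < d -> Num.max (N (x + v)) y = y + dotp a v) -> a = 0.
  move=> lt d0 hd; apply/eqP/negPn/negP => a0.
  have m0 : 0 < Num.min d (y - N x) by rewrite lt_min d0 /=; lra.
  have [t /andP[t0 _]] := small_scale hN a m0; rewrite lt_min => /andP[td ty].
  have := hd _ td; rewrite max_r; last by have := normD hN x (t *: a); lra.
  rewrite dotpZr => /eqP; rewrite -subr_eq0 opprD addNKr oppr_eq0 mulf_eq0.
  by rewrite !gt_eqF // dotp_gt0.
have hl v : N1 v < e -> Num.max (N1 (lsubmx z + v)) (N2 (rsubmx z)) =
    maxN N1 N2 z + dotp (lsubmx c) v.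
  move=> ve; have := h (row_mx v 0); rewrite {1 2}/maxN lsubmxD rsubmxD.
  rewrite !row_mxKl !row_mxKr addr0 dotp_sub row_mxKl row_mxKr dotp0r addr0.
  by apply; rewrite gt_max ve (norm_zero h2).
have hr v : N2 v < e -> Num.max (N1 (lsubmx z)) (N2 (rsubmx z + v)) =
    maxN N1 N2 z + dotp (rsubmx c) v.
  move=> ve; have := h (row_mx 0 v); rewrite {1 2}/maxN lsubmxD rsubmxD.
  rewrite !row_mxKl !row_mxKr addr0 dotp_sub row_mxKl row_mxKr dotp0r add0r.
  by apply; rewrite gt_max ve (norm_zero h1) andbT.
case: (ltgtP (N1 (lsubmx z)) (N2 (rsubmx z))) => [lt|lt|eq]; [right|left|].
- split=> //; exists (rsubmx c).
    pose d := N2 (rsubmx z) - N1 (lsubmx z).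
    exists (Num.min e d); first by rewrite lt_min e0 /= /d; lra.
    move=> v; rewrite lt_min => /andP[ve vd]; move: (hr v ve).
    rewrite /maxN [in RHS]max_r ?(ltW lt) // max_r //.
    have := normD h2 (rsubmx z + v) (- v).
    by rewrite addrK (normNv h2); move: vd; rewrite /d; lra.
  rewrite -{1}(hsubmxK c); congr row_mx; apply: (sm _ _ h1 _ _ _ _ lt e0) => v ve.
  by rewrite hl // /maxN max_r // ltW.
- split=> //; exists (lsubmx c).
    pose d := N1 (lsubmx z) - N2 (rsubmx z).
    exists (Num.min e d); first by rewrite lt_min e0 /= /d; lra.
    move=> v; rewrite lt_min => /andP[ve vd]; move: (hl v ve).
    rewrite /maxN [in RHS]max_l ?(ltW lt) // max_l //.
    have := normD h1 (lsubmx z + v) (- v).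
    by rewrite addrK (normNv h1); move: vd; rewrite /d; lra.
  rewrite -{1}(hsubmxK c); congr row_mx; apply: (sm _ _ h2 _ _ _ _ lt e0) => v ve.
  by rewrite maxC hr // /maxN max_l // ltW.
- exfalso; move/negP: z0; apply; apply/eqP.
  suff xz : N1 (lsubmx z) = 0.
    rewrite -(hsubmxK z) (normv_eq0 h1 xz) (_ : rsubmx z = 0) ?row_mx0 //.
    apply: (normv_eq0 h2).
    by rewrite -eq.
  have [t /andP[t0 t1] ht] := small_scale h1 (lsubmx z) e0.
  have := hl _ ht; have := hl (- (t *: lsubmx z)); rewrite (normNv h1) => /(_ ht).
  have -> : lsubmx z - t *: lsubmx z = (1 - t) *: lsubmx z.
    by rewrite scalerBl scale1r.
  have -> : lsubmx z + t *: lsubmx z = (1 + t) *: lsubmx z.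
    by rewrite scalerDl scale1r.
  rewrite !(normZ h1) -eq /maxN -eq maxxx dotpNr.
  have p := normv_ge0 h1 (lsubmx z).
  rewrite !ger0_norm; try lra.
  rewrite max_r; last nra.
  rewrite max_l; last nra.
  move=> e1 e2; have /eqP : t * N1 (lsubmx z) = 0 by lra.
  by rewrite mulf_eq0 gt_eqF //= => /eqP.
Qed.

End SumMax.

(** * Facets and outer normals of unit balls *)

Section Smooth.
Variables (R : realType) (n : nat) (N : 'rV[R]_n -> R).
Hypothesis hN : is_norm N.

(** Near [x] the norm equals its expansion exactly, so the remainder is zero; the work left is the
    continuity of [dotp a]. *)
Lemma outer_normal_ball x a : locally_affine N x a ->
  outer_normal [set y | N y <= 1] x = a.
Proof.
move=> xa; have [e e0 h] := xa.
rewrite /outer_normal (gauge_ball hN).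
have lin : linear (dotp a : 'rV[R]_n -> R).
  by move=> c u v; rewrite dotpDr dotpZr.
pose D := GRing.isLinear.Build R 'rV[R]_n R _ _ lin.
pose F : {linear 'rV[R]_n -> R} := HB.pack (dotp a) D.
have Fc : continuous F.
  have le_C v : `|dotp a v| <= (\sum_i `|a 0 i|) * N v.
    rewrite dotpE mulr_suml (le_trans (ler_norm_sum _ _ _)) // ler_sum // => i _.
    by rewrite normrM ler_wpM2l // (norm_ge_coord hN).
  have C0 : 0 <= \sum_i `|a 0 i| by apply: sumr_ge0.
  move=> u A /nbhs_ballP [d /= d0 hA].
  change (nbhs u (fun y => A (dotp a y))); apply: (proj2 (norm_nbhsP hN u _)).
  exists (d / (1 + \sum_i `|a 0 i|)); first by rewrite divr_gt0 //; lra.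
  move=> y; rewrite ltr_pdivlMr; last lra.
  move=> hy /=; apply: hA; rewrite -ball_normE /= distrC; apply: le_lt_trans hy.
  have := le_C (y - u); have := normv_ge0 hN (y - u); rewrite dotpDr dotpNr; nra.
apply/rowP => j; rewrite mxE (diff_unique Fc).
  rewrite /= dotpE (bigD1 j) //= mxE !eqxx mulr1 big1 ?addr0 // => i ij.
  by rewrite mxE (negbTE ij) andbF mulr0.
apply/eqaddoP => d d0; apply/(norm_nbhsP hN); exists e => // y.
rewrite subr0 => hy /=.
rewrite /= !fctE /= /shift /= (addrC y) h // subrr normr0 mulr_ge0 // ltW //.
Qed.

(** The facet is cut out by the hyperplane where [dotp a] is 1: near [x] this hyperplane lies in the
    ball, because there the norm agrees with [dotp a]. *)
Lemma laff_smooth_point x a : (0 < n)%N -> N x = 1 -> locally_affine N x a ->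
  smooth_point [set y | N y <= 1] x.
Proof.
move=> n0 x1 xa; have [e e0 h] := xa.
have ax := laff_dot hN xa; rewrite x1 in ax.
set K := [set y | _]; pose P := [set y | dotp a y = 1].
have near_K y : P y -> N (y - x) < e -> K y.
  move=> Py hy; rewrite /K /= -(subrK x y) addrC h // x1 dotpDr dotpNr Py ax subrr.
  by rewrite addr0.
have affE : aff_hull (K `&` P) = P.
  apply/seteqP; split=> y.
    move=> [m [A [c [hA c1 ->]]]]; rewrite /P /= mulmx_sum_row.
    rewrite dotpC /dotp mulmx_suml summxE -c1; apply: eq_bigr => i _.
    rewrite -scalemxAl mxE -/(dotp _ _) dotpC.
    by have [_ ->] := hA i; rewrite mulr1.
  move=> Py; have [t /andP[t0 t1] ht] := small_scale hN (y - x) e0.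
  pose w := x + t *: (y - x).
  have Pw : P w by rewrite /P /= dotpDr dotpZr dotpDr dotpNr Py ax subrr mulr0 addr0.
  have Kw : K w by apply: near_K => //; rewrite /w addrC addKr.
  (* Each [y] of the hyperplane is [(1 - 1/t) x + (1/t) w], with [w] a point of the facet close to
     [x]. *)
  exists 2, (\matrix_(i < 2) (if i == 0 then x else w)),
    (\row_i (if i == 0 then 1 - t^-1 else t^-1)); split.
  - move=> i; rewrite rowK; case: ifP => _; last by split.
    by split => //; rewrite /K /= x1.
  - by rewrite !big_ord_recl big_ord0 !mxE /=; ring.
  - rewrite mulmx_sum_row !big_ord_recl big_ord0 !rowK !mxE /= addr0.
    apply/rowP => j; rewrite !mxE; field; rewrite gt_eqF //.
exists (K `&` P).
  exists a, 1; split => //.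
  - by apply/negP => /eqP a0; move: ax; rewrite a0 dotp0l => /eqP; rewrite eq_sym oner_eq0.
  - move=> y Ky; exact: le_trans (laff_le hN y xa) Ky.
split; first by split; rewrite /K /= ?x1.
rewrite affE; change (nbhs x (fun y => P y -> (K `&` P) y)).
apply: (proj2 (norm_nbhsP hN x _)); exists e => // y hy Py.
by split => //; exact: near_K.
Qed.

(** Once [b > 0], the form [a / b] is bounded by the norm. Conversely [x + h], rescaled to the
    hyperplane, lands in the facet, which bounds the norm by [a / b] near [x]. *)
Lemma smooth_point_laff x : smooth_point [set y | N y <= 1] x ->
  N x = 1 /\ exists a, locally_affine N x a.
Proof.
move=> [F [a [b [a0 hab FE affE]]] [Fx nF]].
have [Kx /= abx] : ([set y | N y <= 1] `&` [set y | dotp a y = b]) x by rewrite -FE.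
(* A positive multiple of [a] lies in the ball and pairs positively with [a]. *)
have b0 : 0 < b.
  have ha : N (- ((1 + N a)^-1 *: - a)) <= 1.
    have := normv_ge0 hN a => p.
    rewrite (normNv hN) (normZ hN) (normNv hN) ger0_norm ?invr_ge0; last lra.
    by rewrite mulrC ler_pdivrMr; lra.
  have := hab _ ha; rewrite dotpNr dotpZr dotpNr mulrN opprK.
  apply: lt_le_trans; apply: mulr_gt0; last exact: dotp_gt0.
  by rewrite invr_gt0; have := normv_ge0 hN a; lra.
have le_N y : dotp a y <= b * N y.
  have [->|y0] := eqVneq y 0; first by rewrite dotp0r (norm_zero hN) mulr0.
  have p := normv_gt0 hN y0.
  have hy : N ((N y)^-1 *: y) <= 1.
    by rewrite (normZ hN) ger0_norm ?invr_ge0 ?(ltW p) // mulVf // gt_eqF.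
  have := hab _ hy; rewrite dotpZr mulrC ler_pdivrMr //.
have x1 : N x = 1.
  apply/eqP; rewrite eq_le; apply/andP; split; first exact: Kx.
  by have := le_N x; rewrite abx ler_pMr.
split => //; exists (b^-1 *: a).
move: nF; rewrite affE.
move=> nF; have {}nF : nbhs x (fun y => dotp a y = b -> F y) := nF.
move: nF => /(norm_nbhsP hN) [e e0 hF].
have le_N' y : `|dotp (b^-1 *: a) y| <= N y.
  rewrite ler_norml dotpZl ler_pdivrMl // le_N andbT -(normNv hN) lerNl -mulrN.
  by rewrite -dotpNr ler_pdivrMl.
have bx : dotp (b^-1 *: a) x = 1 by rewrite dotpZl abx mulVf // gt_eqF.
(* The first bound keeps [1 + c] above [1 / 2]; the rescaled point then moves by at most
   [4 * N h < e]. *)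
exists (Num.min (1 / 2) (e / 4)); first by rewrite lt_min; apply/andP; split; lra.
move=> h; rewrite lt_min => /andP[h12 he].
have := le_N' h; set c := dotp _ h => hc.
have c2 : - (1 / 2) < c < 1 / 2 by rewrite -ltr_norml; lra.
have cp : 0 < 1 + c by lra.
pose y := (1 + c)^-1 *: (x + h).
have yF : N y <= 1.
  have : F y; last by rewrite FE => -[].
  apply: hF.
    have -> : y - x = (1 + c)^-1 *: (h - c *: x).
      by apply/rowP => j; rewrite !mxE; field; rewrite gt_eqF.
    rewrite (normZ hN) gtr0_norm ?invr_gt0 // ltr_pdivrMl //.
    have := normD hN h (- (c *: x)); rewrite (normNv hN) (normZ hN) x1 mulr1.
    nra.
  rewrite /= /y dotpZr dotpDr abx.
  have -> : dotp a h = b * c by rewrite /c dotpZl mulrA divff ?mul1r // gt_eqF.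
  by field; rewrite gt_eqF.
have : N (x + h) <= 1 + c.
  by move: yF; rewrite /y (normZ hN) gtr0_norm ?invr_gt0 // ler_pdivrMl // mulr1.
have := le_N' (x + h); rewrite dotpDr bx -/c (gtr0_norm cp) x1 => u v.
by apply/eqP; rewrite eq_le v u.
Qed.

End Smooth.

(** * Dual pairs of Hanner norms *)

Section HannerPairs.
Variable R : realType.

Definition absN (x : 'rV[R]_1) : R := `|x 0 0|.

(** Both norms are built in parallel, so that duality is a symmetry of the relation exchanging the
    last two rules. *)
Inductive hpair : forall n, ('rV[R]_n -> R) -> ('rV[R]_n -> R) -> Prop :=
| hpair_abs : hpair absN absN
| hpair_sum k l (N1 M1 : 'rV[R]_k -> R) (N2 M2 : 'rV[R]_l -> R) :
    hpair N1 M1 -> hpair N2 M2 -> hpair (sumN N1 N2) (maxN M1 M2)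
| hpair_max k l (N1 M1 : 'rV[R]_k -> R) (N2 M2 : 'rV[R]_l -> R) :
    hpair N1 M1 -> hpair N2 M2 -> hpair (maxN N1 N2) (sumN M1 M2).

Lemma hpair_sym n (N M : 'rV[R]_n -> R) : hpair N M -> hpair M N.
Proof. by elim=> *; constructor. Qed.

Lemma is_norm_abs : is_norm absN.
Proof.
split=> [x y|t x|x j|x]; rewrite /absN ?mxE.
- exact: ler_normD.
- by rewrite normrM.
- by rewrite (ord1 j).
- by rewrite big_ord1.
Qed.

Lemma hpair_norm n (N M : 'rV[R]_n -> R) : hpair N M -> is_norm N.
Proof.
elim=> [|k l N1 M1 N2 M2 _ h1 _ h2|k l N1 M1 N2 M2 _ h1 _ h2].
- exact: is_norm_abs.
- exact: is_norm_sum.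
- exact: is_norm_max.
Qed.

Lemma hpair_norm_dual n (N M : 'rV[R]_n -> R) : hpair N M -> is_norm M.
Proof. by move/hpair_sym/hpair_norm. Qed.

Lemma hpair_dim n (N M : 'rV[R]_n -> R) : hpair N M -> (0 < n)%N.
Proof. by elim=> // *; rewrite addn_gt0; apply/orP; left. Qed.

Lemma laff_abs x a : locally_affine absN x a -> a 0 0 = 1 \/ a 0 0 = -1.
Proof.
move=> xa; have := laff_neq0 is_norm_abs (ltn0Sn 0) xa => x0.
have x00 : x 0 0 != 0.
  by apply: contra x0 => /eqP h; apply/eqP/rowP => j; rewrite (ord1 j) h mxE.
have := laff_dot is_norm_abs xa; rewrite dotpE big_ord1 /absN.
case: (ler0P (x 0 0)) => _; last first.
  by rewrite -[RHS]mul1r => /(mulIf x00); left.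
by rewrite -[RHS]mulN1r => /(mulIf x00); right.
Qed.

(** The slope of a maximum is supported in one block, so the pairing reduces to that block; in
    dimension one both slopes are signs. *)
Lemma hpair_slopes n (N M : 'rV[R]_n -> R) x p a b : hpair N M ->
  locally_affine N x a -> locally_affine M p b -> dotp a b = 1 \/ dotp a b = -1.
Proof.
move=> h; elim: h x p a b => [|k l N1 M1 N2 M2 h1 IH1 h2 IH2|k l N1 M1 N2 M2 h1 IH1 h2 IH2] x p a b.
- move=> /laff_abs ha /laff_abs hb; rewrite dotpE big_ord1.
  case: ha => ->; case: hb => ->; rewrite ?(mulr1, mul1r, mulrNN); tauto.
- move=> /(laff_sum (hpair_norm h1) (hpair_norm h2)) [xa ya].
  have kl : (0 < k + l)%N by rewrite addn_gt0 (hpair_dim h1).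
  case/(laff_max (hpair_norm_dual h1) (hpair_norm_dual h2) kl) => -[_ [c hc ->]];
    rewrite dotpC dotp_row dotp0l ?addr0 ?add0r dotpC.
    exact: IH1 xa hc.
  exact: IH2 ya hc.
- move=> xa' /(laff_sum (hpair_norm_dual h1) (hpair_norm_dual h2)) [xa ya].
  have kl : (0 < k + l)%N by rewrite addn_gt0 (hpair_dim h1).
  move: xa'; case/(laff_max (hpair_norm h1) (hpair_norm h2) kl) => -[_ [c hc ->]];
    rewrite dotp_row dotp0l ?addr0 ?add0r.
    exact: IH1 hc xa.
  exact: IH2 hc ya.
Qed.

Lemma hpair_slopes_neq0 n (N M : 'rV[R]_n -> R) x p a b : hpair N M ->
  locally_affine N x a -> locally_affine M p b -> dotp a b != 0.
Proof.
move=> h xa pb; case: (hpair_slopes h xa pb) => ->; rewrite ?oppr_eq0 oner_eq0 //.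
Qed.

(** Hölder's inequality. Its bound is attained for a maximum by a vector in the dominating block,
    for a sum by joining the maximizers of both blocks. *)
Lemma hpair_dual n (N M : 'rV[R]_n -> R) : hpair N M ->
  (forall p q, dotp p q <= M p * N q) /\
  (forall p, exists2 q, N q <= 1 & dotp p q = M p).
Proof.
elim=> [|k l N1 M1 N2 M2 h1 [le1 at1] h2 [le2 at2]|k l N1 M1 N2 M2 h1 [le1 at1] h2 [le2 at2]].
- split=> p; last first.
    exists (const_mx (Num.sg (p 0 0))); rewrite ?dotpE ?big_ord1 /absN !mxE.
      by rewrite normr_sg; case: (_ != 0).
    by rewrite normrEsg mulrC.
  by move=> q; rewrite dotpE big_ord1 /absN -normrM ler_norm.
- have n1 := hpair_norm h1; have n2 := hpair_norm h2.
  split=> p.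
    move=> q; rewrite dotp_sub /sumN mulrDr; apply: lerD.
      apply: le_trans (le1 _ _) _; rewrite ler_wpM2r ?(normv_ge0 n1) //.
      by rewrite le_max lexx.
    apply: le_trans (le2 _ _) _; rewrite ler_wpM2r ?(normv_ge0 n2) //.
    by rewrite le_max lexx orbT.
  rewrite /maxN; case: (leP (M1 (lsubmx p)) (M2 (rsubmx p))) => _.
    have [q q1 <-] := at2 (rsubmx p); exists (row_mx 0 q).
      by rewrite /sumN row_mxKl row_mxKr (norm_zero n1) add0r.
    by rewrite dotpC dotp_row dotp0l add0r dotpC.
  have [q q1 <-] := at1 (lsubmx p); exists (row_mx q 0).
    by rewrite /sumN row_mxKl row_mxKr (norm_zero n2) addr0.
  by rewrite dotpC dotp_row dotp0l addr0 dotpC.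
- have n1 := hpair_norm_dual h1; have n2 := hpair_norm_dual h2.
  split=> p.
    move=> q; rewrite dotp_sub /sumN mulrDl; apply: lerD.
      apply: le_trans (le1 _ _) _; rewrite ler_wpM2l ?(normv_ge0 n1) //.
      by rewrite le_max lexx.
    apply: le_trans (le2 _ _) _; rewrite ler_wpM2l ?(normv_ge0 n2) //.
    by rewrite le_max lexx orbT.
  have [q1 hq1 e1] := at1 (lsubmx p); have [q2 hq2 e2] := at2 (rsubmx p).
  exists (row_mx q1 q2); first by rewrite /maxN row_mxKl row_mxKr ge_max hq1.
  by rewrite dotpC dotp_row !(dotpC q1, dotpC q2) e1 e2.
Qed.

Lemma hpair_polar n (N M : 'rV[R]_n -> R) : hpair N M ->
  polar [set x | N x <= 1] = [set x | M x <= 1].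
Proof.
move=> h; have [le at_] := hpair_dual h.
apply/seteqP; split=> p /=.
  by move=> hp; have [q q1 <-] := at_ p; exact: hp.
move=> hp q /= hq; apply: le_trans (le p q) _.
by rewrite mulr_ile1 // ?(normv_ge0 (hpair_norm h)) ?(normv_ge0 (hpair_norm_dual h)).
Qed.

Lemma hanner_hpair n (K : set 'rV[R]_n) : hanner K ->
  exists N M, hpair N M /\ K = [set x | N x <= 1].
Proof.
elim=> [|k l {}K L _ [N1 [M1 [h1 ->]]] _ [N2 [M2 [h2 ->]]]|
         k l {}K L _ [N1 [M1 [h1 ->]]] _ [N2 [M2 [h2 ->]]]].
- exists absN, absN; split; first exact: hpair_abs.
  by apply/seteqP; split=> x /=; rewrite /absN ler_norml.
- exists (sumN N1 N2), (maxN M1 M2); split; first exact: hpair_sum.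
  by rewrite /sum1 (gauge_ball (hpair_norm h1)) (gauge_ball (hpair_norm h2)).
- exists (maxN N1 N2), (sumN M1 M2); split; first exact: hpair_max.
  by rewrite /sumoo (gauge_ball (hpair_norm h1)) (gauge_ball (hpair_norm h2)).
Qed.

End HannerPairs.

(** * The length of closed trajectories *)

Section Traces.
Variables (R : realType) (n : nat).
Implicit Types (N M : 'rV[R]_n -> R) (z w : 'rV[R]_n * 'rV[R]_n).

Definition regular_state N M z :=
  [/\ N z.1 = 1, M z.2 = 1, exists a, locally_affine N z.1 a &
      exists b, locally_affine M z.2 b].

Definition bounce N M z (lam mu : R) z' := exists a b,
  [/\ locally_affine N z.1 a, locally_affine M z'.2 b, z'.2 = z.2 - lam *: a,
      z'.1 = z.1 + mu *: b & 0 < lam /\ 0 < mu].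

(* [trace N M z s L]: from [z] the successive states are those of [s], and the
   total length travelled by the momentum, measured by the multipliers of the
   normals, is [L]. *)
Fixpoint trace N M z s (L : R) : Prop :=
  if s is z' :: s' then
    exists lam mu L', [/\ regular_state N M z, bounce N M z lam mu z',
                          trace N M z' s' L' & L = lam + L']
  else regular_state N M z /\ L = 0.

Lemma trace_regular N M z s L : trace N M z s L ->
  forall w, w \in z :: s -> regular_state N M w.
Proof.
elim: s z L => [z L [gz _] w|z' s IH z L [lam [mu [L' [gz _ tr _]]]] w].
  by rewrite inE => /eqP ->.
by rewrite inE => /orP[/eqP -> //|]; apply: IH tr _.
Qed.

Lemma trace_ge0 N M z s L : trace N M z s L -> 0 <= L /\ (s != [::] -> 0 < L).
Proof.
elim: s z L => [z L [_ ->] //|z' s IH z L [lam [mu [L' [_ hb tr ->]]]]].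
have [] := IH _ _ tr; have [a [b [_ _ _ _ [l0 _]]]] := hb.
by move=> ? _; split=> // *; lra.
Qed.

Lemma trace_cat N M z s t L : trace N M z (s ++ t) L <->
  exists L1 L2, [/\ trace N M z s L1, trace N M (last z s) t L2 & L = L1 + L2].
Proof.
elim: s z L => [|z' s IH] z L /=.
  split=> [tr|[L1 [L2 [[_ ->] tr ->]]]]; last by rewrite add0r.
  exists 0, L; split=> //; last by rewrite add0r.
  by split=> //; apply: (trace_regular tr); rewrite inE eqxx.
split.
  move=> [lam [mu [L' [gz hb /IH [L1 [L2 [t1 t2 ->]]] ->]]]].
  exists (lam + L1), L2; split=> //; last by rewrite addrA.
  by exists lam, mu, L1.
move=> [L1 [L2 [[lam [mu [L' [gz hb tr ->]]]] t2 ->]]].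
exists lam, mu, (L' + L2); split=> //; last by rewrite addrA.
by apply/IH; exists L', L2.
Qed.

(** Lets a closed trace start at a hit of a given block, with the same length and counts. *)
Lemma trace_rot N M z s L (P : pred _) : trace N M z s L -> last z s = z ->
  has P s -> exists z' s', [/\ trace N M z' s' L, last z' s' = z', P z' &
    forall Q : pred _, count Q s' = count Q s].
Proof.
move=> tr lz /hasP[z' zs Pz']; have [s1 [s2 es]] : exists s1 s2, s = rcons s1 z' ++ s2.
  by case/path.splitP: zs => s1 s2; exists s1, s2.
move: tr lz; rewrite es => /trace_cat [L1 [L2 [t1]]].
rewrite last_cat last_rcons => t2 eL lz.
exists z', (s2 ++ rcons s1 z'); split=> //.
- by apply/trace_cat; exists L2, L1; rewrite lz; split=> //; rewrite addrC.
- by rewrite last_cat last_rcons.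
- by move=> Q; rewrite !count_cat addnC.
Qed.

(** Imposed on every closed trace, with any number of states, so that simplicity need not be tracked
    through projections. *)
Definition length_law N M := forall z s L,
  trace N M z s L -> last z s = z -> n%:R * L = 2 * (size s)%:R.

Section Swap.
Variables N M : 'rV[R]_n -> R.
Hypotheses (hN : is_norm N) (hM : is_norm M).

(** The two coordinates move alternately, so a swapped state pairs the momentum of [z'] with the
    bounce point of [z]; the sign turns the position rule into the momentum rule. *)
Definition swap z z' : 'rV[R]_n * 'rV[R]_n := (z'.2, - z.1).

Fixpoint swaps z s := if s is z' :: s' then swap z z' :: swaps z' s' else [::].

Lemma regular_swap z z' : regular_state N M z -> regular_state N M z' ->
  regular_state M N (swap z z').
Proof.
move=> [Nz _ [a ha] _] [_ Mz' _ [b hb]]; split=> //=.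
- by rewrite (normNv hN).
- by exists b.
- by exists (- a); exact: laff_opp.
Qed.

Lemma bounce_swap z lam mu z' lam' mu' z'' : bounce N M z lam mu z' ->
  bounce N M z' lam' mu' z'' -> bounce M N (swap z z') mu lam' (swap z' z'').
Proof.
move=> [a [b [za zb e1 e2 [l0 m0]]]] [a' [b' [za' zb' e1' e2' [l0' m0']]]].
exists b, (- a'); split=> //=; first exact: laff_opp.
- by rewrite e2 opprD.
- by rewrite e1' scalerN.
Qed.

(** Slopes pair to 1 with their base points, so one step changes [dotp p q] by [mu - lam]; around a
    closed trajectory this telescopes. *)
Lemma bounce_energy z lam mu z' : M z'.2 = 1 -> N z.1 = 1 ->
  bounce N M z lam mu z' -> mu = lam + dotp z'.2 z'.1 - dotp z.2 z.1.
Proof.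
move=> M1 N1 [a [b [za zb e1 e2 _]]].
have := laff_dot hN za; rewrite N1 => az.
have := laff_dot hM zb; rewrite M1 => bz.
rewrite e2 dotpDr dotpZr (dotpC _ b) bz e1 dotpDl dotpNl dotpZl az; ring.
Qed.

(** The [mu] add up to the [lam] corrected by the change of the pairing. The extra state [w] is
    there because a swapped state uses two consecutive ones. *)
Lemma trace_swap z lam mu z' s L lam' mu' w : regular_state N M z ->
  bounce N M z lam mu z' ->
  trace N M z' s L -> regular_state N M w -> bounce N M (last z' s) lam' mu' w ->
  trace M N (swap z z') (swaps z' (rcons s w))
    (lam + L + dotp (last z' s).2 (last z' s).1 - dotp z.2 z.1).
Proof.
move=> + + + gw; elim: s z lam mu z' L => [|z1 s IH] z lam mu z' L gz hb /=.
  move=> [gz' ->] hw; exists mu, lam', 0; split.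
  - exact: regular_swap.
  - exact: bounce_swap hb hw.
  - by split=> //; exact: regular_swap.
  - by rewrite (bounce_energy _ _ hb); [ring | case: gz' | case: gz].
move=> [lam1 [mu1 [L' [gz' hb' tr ->]]]] hw.
exists mu, lam1; eexists; split.
- exact: regular_swap.
- exact: bounce_swap hb hb'.
- exact: IH gz' hb' tr hw.
- by rewrite (bounce_energy _ _ hb); [ring | case: gz' | case: gz].
Qed.

Lemma length_law_swap : length_law M N -> length_law N M.
Proof.
move=> law z [|z' s] L.
  by move=> [_ ->] _; rewrite !mulr0.
move=> tr0 /= lz; have gr := trace_regular tr0.
move: tr0 => [lam [mu [L' [gz hb tr eL]]]].
have gz' : regular_state N M z' by apply: gr; rewrite !inE eqxx orbT.
(* Taking [z'] again after the last state closes the swapped trace and cancels the pairings. *)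
have := trace_swap gz hb tr gz'; rewrite lz => /(_ _ _ hb) tr'.
have := law _ _ _ tr'; rewrite addrK -eL => ->.
  have sz t v : size (swaps v t) = size t by elim: t v => //= x t IH v; rewrite IH.
  by rewrite sz size_rcons.
have lst t v u w : last (swap u v) (swaps v (rcons t w)) = swap (last v t) w.
  by elim: t u v => //= x t IH u v; rewrite IH.
by rewrite lst lz.
Qed.

End Swap.
End Traces.

(** * Projection of a trajectory to one block *)

Section Projection.
Variables (R : realType) (n k : nat).
(** [f] is either block of coordinates, [g] the norm of the other block, and [ty p] says that this
    block carries the maximum at the momentum [p], so that its position is the one to move. *)
Variables (N M : 'rV[R]_n -> R) (N1 M1 : 'rV[R]_k -> R).
Variables (f : 'rV[R]_n -> 'rV[R]_k) (g : 'rV[R]_n -> R).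
Variable (ty : 'rV[R]_n -> bool).
Hypotheses (k0 : (0 < k)%N) (hN1 : is_norm N1).
Hypotheses (fD : forall x y, f (x + y) = f x + f y)
  (fZ : forall c x, f (c *: x) = c *: f x).
Hypothesis N_split : forall q, N q = N1 (f q) + g q.
Hypothesis laff_f : forall q a, locally_affine N q a -> locally_affine N1 (f q) (f a).
Hypothesis laff_hit : forall p b, locally_affine M p b -> ty p ->
  [/\ M p = M1 (f p), locally_affine M1 (f p) (f b) &
      forall q mu, g (q + mu *: b) = g q].
Hypothesis laff_miss : forall p b, locally_affine M p b -> ~~ ty p -> f b = 0.
Implicit Types (z w : 'rV[R]_n * 'rV[R]_n).

(** The position block keeps a constant norm [al], divided out to return to the unit sphere. *)
Definition proj_state (al : R) z := (al^-1 *: f z.1, f z.2).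

Let fB x c y : f (x - c *: y) = f x - c *: f y.
Proof. by rewrite -scaleN1r fD !fZ scaleN1r. Qed.

Lemma regular_proj al z : 0 < al -> N1 (f z.1) = al -> ty z.2 ->
  regular_state N M z -> regular_state N1 M1 (proj_state al z).
Proof.
move=> al0 xal tz [Nz Mz [a ha] [b hb]].
have [e lb _] := laff_hit hb tz; split=> /=.
- by rewrite (normZ hN1) xal gtr0_norm ?invr_gt0 // mulVf // gt_eqF.
- by rewrite -e.
- by exists (f a); apply: laff_scale; rewrite ?invr_gt0 //; exact: laff_f.
- by exists (f b).
Qed.

(* Between two hits of the first component, [f z.1] rests and [f z.2] moves
   straight along the normal at it; [c] is the length already travelled since
   the last hit [zl]. *)
Lemma trace_proj al z s L zl a1 c : 0 < al -> trace N M z s L ->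
  regular_state N1 M1 zl -> f z.1 = al *: zl.1 -> locally_affine N1 zl.1 a1 ->
  f z.2 = zl.2 - c *: a1 -> 0 <= c -> ty (last z s).2 -> (ty z.2 -> c = 0) ->
  trace N1 M1 zl [seq proj_state al w | w <- s & ty w.2] (c + L).
Proof.
move=> al0; elim: s z L zl a1 c => [|z' s IH] z L zl a1 c.
  by move=> [_ ->] gl _ _ _ _ tz /(_ tz) -> /=; rewrite add0r.
move=> tr0; have gz' : regular_state N M z'.
    by apply: (trace_regular tr0); rewrite !inE eqxx orbT.
move: tr0 => [lam [mu [L' [gz hb tr ->]]]] gl xz la pz c0 tl tz.
have [a [b [za zb e1 e2 [l0 m0]]]] := hb.
have fa : f a = a1.
  apply: (laff_unique hN1 _ la).
  have -> : zl.1 = al^-1 *: f z.1 by rewrite xz scalerA mulVf ?scale1r // gt_eqF.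
  by apply: (laff_scale hN1); rewrite ?invr_gt0 //; exact: laff_f.
have xal : N1 (f z.1) = al.
  by rewrite xz (normZ hN1) gtr0_norm // (_ : N1 zl.1 = 1) ?mulr1 //; case: gl.
have p' : f z'.2 = zl.2 - (c + lam) *: a1.
  by rewrite e1 fB pz fa scalerDl opprD addrA.
rewrite /=; case: ifPn => tz'.
  have [_ lb gb] := laff_hit zb tz'.
  (* The other block rests and the two norms add up to 1 before and after, so this block keeps its
     norm. *)
  have xal' : N1 (f z'.1) = al.
    have gz1 : g z'.1 = g z.1 by rewrite e2 gb.
    have := N_split z'.1; rewrite gz1.
    have [-> _ _ _] := gz'; have := N_split z.1; have [-> _ _ _] := gz.
    by rewrite xal => -> /addIr.
  have gp := regular_proj al0 xal' tz' gz'.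
  have [_ _ [a' ha'] _] := gp.
  (* After a hit the length travelled restarts at [0]. *)
  have := IH z' L' (proj_state al z') a' 0 tr gp; rewrite add0r => tr'.
  exists (c + lam), (al^-1 * mu), L'; split=> //; last by rewrite addrA.
    exists a1, (f b); split=> //=.
      by rewrite e2 fD fZ xz scalerDr !scalerA mulVf ?scale1r // gt_eqF.
    by split; [lra | rewrite mulr_gt0 // invr_gt0].
  apply: tr' => //.
  - by rewrite /= scalerA divff ?scale1r // gt_eqF.
  - by rewrite /= scale0r subr0.
rewrite addrA; apply: (IH z' L' zl a1 (c + lam)) => //.
- by rewrite e2 fD fZ (laff_miss zb tz') scaler0 addr0.
- lra.
- by rewrite (negbTE tz').
Qed.

Lemma trace_miss z s L a : trace N M z s L -> ~~ has (fun w => ty w.2) s ->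
  locally_affine N1 (f z.1) a ->
  f (last z s).2 = f z.2 - L *: a.
Proof.
elim: s z L => [z L [_ ->] _ _|z' s IH z L]; first by rewrite scale0r subr0.
move=> [lam [mu [L' [gz [a' [b [za zb e1 e2 _]]] tr ->]]]] /=.
rewrite negb_or => /andP[tz' hs] la.
have fa : f a' = a by apply: (laff_unique hN1 _ la); exact: laff_f.
rewrite (IH z' L') //.
  by rewrite e1 fB fa scalerDl opprD addrA.
by rewrite e2 fD fZ (laff_miss zb tz') scaler0 addr0.
Qed.

(** A closed trajectory must hit this block, as otherwise its momentum would drift by a nonzero
    vector. Started at a hit, it projects to a closed trace with one state per hit and the same
    length. *)
Lemma proj_length_law z s L : length_law N1 M1 -> trace N M z s L ->
  last z s = z -> s != [::] -> k%:R * L = 2 * (count (fun w => ty w.2) s)%:R.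
Proof.
move=> law tr lz s0; have [hs|hs] := boolP (has (fun w => ty w.2) s); last first.
  have [_ _ [a ha] _] := trace_regular tr (mem_head _ _).
  have := trace_miss tr hs (laff_f ha); rewrite lz => /eqP.
  rewrite -subr_eq0 opprD addNKr !oppr_eq0 scaler_eq0 gt_eqF /=; last first.
    exact: (trace_ge0 tr).2.
  move=> /eqP fa; have := laff_neq0 hN1 k0 (laff_f ha).
  move=> /(normv_gt0 hN1); rewrite -(laff_dot hN1 (laff_f ha)) fa dotp0l ltxx //.
have [z' [s' [tr' lz' tz' cnt]]] := trace_rot tr lz hs.
rewrite -cnt; have gz := trace_regular tr' (mem_head _ _).
have [_ _ [a ha] _] := gz.
pose al := N1 (f z'.1).
have al0 : 0 < al := normv_gt0 hN1 (laff_neq0 hN1 k0 (laff_f ha)).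
have gp := regular_proj al0 erefl tz' gz; have [_ _ [a1 ha1] _] := gp.
have := @trace_proj al z' s' L (proj_state al z') a1 0 al0 tr' gp.
rewrite add0r /= scalerA divff ?scale1r ?gt_eqF // scale0r subr0 lz'.
move=> /(_ erefl ha1 erefl (lexx _) tz' (fun=> erefl)) tp.
rewrite (law _ _ _ tp) ?size_map ?size_filter //.
case/lastP: s' lz' tz' {tr' cnt tp} => // s' w; rewrite last_rcons => -> tz'.
by rewrite filter_rcons tz' map_rcons last_rcons.
Qed.

End Projection.

(** * The length law by induction *)

Section LengthLaw.
Variable R : realType.

(** At a smooth point of the maximum exactly one block dominates, so the hits of the two blocks add
    up to the number of states. *)
Lemma length_law_sum k l (N1 M1 : 'rV[R]_k -> R) (N2 M2 : 'rV[R]_l -> R) :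
  hpair N1 M1 -> hpair N2 M2 -> length_law N1 M1 -> length_law N2 M2 ->
  length_law (sumN N1 N2) (maxN M1 M2).
Proof.
move=> h1 h2 law1 law2 z s L tr lz.
have n1 := hpair_norm h1; have n2 := hpair_norm h2.
have m1 := hpair_norm_dual h1; have m2 := hpair_norm_dual h2.
have kl : (0 < k + l)%N by rewrite addn_gt0 (hpair_dim h1).
have [s0|s0] := eqVneq s [::].
  by move: tr; rewrite s0 /= => -[_ ->]; rewrite !mulr0.
have := @proj_length_law _ _ _ (sumN N1 N2) (maxN M1 M2) N1 M1 lsubmx
  (fun q => N2 (rsubmx q)) (fun p => M2 (rsubmx p) < M1 (lsubmx p)) (hpair_dim h1)
  n1 (@lsubmxD _ _ _) (@lsubmxZ _ _ _) (fun q => erefl) _ _ _ z s L law1 tr lz s0.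
have := @proj_length_law _ _ _ (sumN N1 N2) (maxN M1 M2) N2 M2 rsubmx
  (fun q => N1 (lsubmx q)) (fun p => M1 (lsubmx p) < M2 (rsubmx p)) (hpair_dim h2)
  n2 (@rsubmxD _ _ _) (@rsubmxZ _ _ _) (fun q => addrC _ _) _ _ _ z s L law2 tr lz s0.
move=> E2 E1; rewrite natrD mulrDl E1 ?E2.
- rewrite -mulrDr -natrD; congr (_ * _%:R).
  rewrite addnC -(count_predC (fun w => M1 (lsubmx w.2) < M2 (rsubmx w.2)) s).
  congr addn; apply: eq_in_count => w ws /=.
  have [_ _ _ [b hb]] : regular_state (sumN N1 N2) (maxN M1 M2) w.
    by apply: (trace_regular tr); rewrite inE ws orbT.
  rewrite -leNgt; have := laff_max m1 m2 kl hb.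
  by case=> -[lt _]; [rewrite lt ltW | rewrite leNgt lt ltNge (ltW lt)].
- by move=> q a /(laff_sum n1 n2) [].
- move=> p b /(laff_max m1 m2 kl) [[lt [c hc ->]]|[lt [c hc ->]]].
    by move=> lt'; have := lt_trans lt lt'; rewrite ltxx.
  move=> _; split=> [||q mu]; rewrite ?row_mxKr //; first by rewrite /maxN max_r // ltW.
  by rewrite lsubmxD lsubmxZ row_mxKl scaler0 addr0.
- move=> p b /(laff_max m1 m2 kl) [[lt [c hc ->]]|[-> //]].
  by rewrite row_mxKr.
- by move=> q a /(laff_sum n1 n2) [].
- move=> p b /(laff_max m1 m2 kl) [[lt [c hc ->]]|[lt [c hc ->]]]; last first.
    by move=> lt'; have := lt_trans lt lt'; rewrite ltxx.
  move=> _; split=> [||q mu]; rewrite ?row_mxKl //; first by rewrite /maxN max_l // ltW.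
  by rewrite rsubmxD rsubmxZ row_mxKr scaler0 addr0.
- move=> p b /(laff_max m1 m2 kl) [[-> //]|[lt [c hc ->]]].
  by rewrite row_mxKl.
Qed.

(** In dimension one the momentum jumps between 1 and -1, so each multiplier is 2. *)
Lemma length_law_abs : length_law (@absN R) (@absN R).
Proof.
move=> z s L tr _; rewrite mul1r; elim: s z L tr => [|z' s IH] z L /=.
  by move=> [_ ->]; rewrite mulr0.
move=> [lam [mu [L' [[_ p1 _ _] [a [b [za zb e1 e2 [l0 _]]]] tr ->]]]].
rewrite (IH _ _ tr) -[(size s).+1]add1n natrD mulrDr; congr (_ + _).
have [_ p1' _ _] := trace_regular tr (mem_head _ _).
move: p1 p1'; rewrite /absN e1 !mxE.
move=> /eqP; rewrite eqr_norml ler01 andbT => /orP[] /eqP ->;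
move=> /eqP; rewrite eqr_norml ler01 andbT => /orP[] /eqP;
case: (laff_abs za) => ->; lra.
Qed.

Lemma hpair_length_law n (N M : 'rV[R]_n -> R) : hpair N M -> length_law N M.
Proof.
elim=> [|k l N1 M1 N2 M2 h1 IH1 h2 IH2|k l N1 M1 N2 M2 h1 IH1 h2 IH2].
- exact: length_law_abs.
- exact: length_law_sum.
- have n1 := hpair_norm h1; have n2 := hpair_norm h2.
  have m1 := hpair_norm_dual h1; have m2 := hpair_norm_dual h2.
  (* The maximum is dual to a sum: swap, and apply the sum case to the factors, swapped as well. *)
  apply: length_law_swap; [exact: is_norm_max|exact: is_norm_sum|].
  by apply: length_law_sum; try exact: hpair_sym; exact: length_law_swap.
Qed.

End LengthLaw.

(** * Closed polygonal lines *)

Section PeriodicSequences.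
Variable T : Type.

Lemma mkseqD (z : nat -> T) m n :
  mkseq z (m + n) = mkseq z m ++ mkseq (fun i => z (m + i)%N) n.
Proof.
rewrite /mkseq iotaD map_cat add0n; congr cat.
by rewrite -{1}(addn0 m) iotaDl -map_comp.
Qed.

Lemma mkseq_flatten (z : nat -> T) d r : (forall i, z (i + d)%N = z i) ->
  mkseq z (r * d) = flatten (nseq r (mkseq z d)).
Proof.
move=> zd; elim: r => [|r IH]; first by rewrite mul0n.
rewrite mulSn mkseqD -[RHS]/(mkseq z d ++ flatten (nseq r (mkseq z d))) -IH.
by congr cat; apply: eq_map => i; rewrite addnC zd.
Qed.

Lemma size_flatten_nseq r (t : seq T) : size (flatten (nseq r t)) = (r * size t)%N.
Proof. by elim: r => //= r IH; rewrite size_cat IH mulSn. Qed.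

Lemma nth_flatten_nseq x0 r (t : seq T) i : (i < r * size t)%N ->
  nth x0 (flatten (nseq r t)) i = nth x0 t (i %% size t).
Proof.
elim: r i => [|r IH] i; first by rewrite mul0n.
rewrite mulSn /= nth_cat => ir; case: ltnP => it; first by rewrite modn_small.
rewrite IH; last by rewrite ltn_subLR.
by rewrite -{2}(subnK it) modnDr.
Qed.

(** Turns a repetition in the finite cycle into a period of the infinite sequence. *)
Lemma flatten_period (z : nat -> T) m r t : (forall i, z (i + m)%N = z i) ->
  (0 < m)%N -> mkseq z m = flatten (nseq r t) -> forall i, z (i + size t)%N = z i.
Proof.
move=> zm m0 e; have x0 := z 0%N.
have em : m = (r * size t)%N by rewrite -(size_mkseq z m) e size_flatten_nseq.
have zmod i : z i = z (i %% m)%N.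
  rewrite {1}(divn_eq i m) addnC; elim: (i %/ m)%N => [|c IH]; first by rewrite addn0.
  by rewrite mulSnr addnA zm.
have zE i : z i = nth x0 t (i %% size t).
  have im : (i %% m < m)%N by rewrite ltn_pmod.
  rewrite zmod -(nth_mkseq x0 z im) e nth_flatten_nseq -?em // modn_dvdm //.
  by rewrite em dvdn_mull.
by move=> i; rewrite !zE modnDr.
Qed.

End PeriodicSequences.

Section ClosedLines.
Variables (R : realType) (n : nat).
Implicit Types (s t : seq 'rV[R]_n) (u v w : 'rV[R]_n).

Lemma scl_rotr s t : same_closed_line (s ++ t) (t ++ s).
Proof. by have := scl_rot (size s) (s ++ t); rewrite rot_size_cat. Qed.

Lemma scl_inside_cat s u v w t (c : R) : 0 <= c <= 1 ->
  v = (1 - c) *: u + c *: w ->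
  same_closed_line (s ++ u :: v :: w :: t) (s ++ u :: w :: t).
Proof.
move=> c01 e; apply: scl_trans (scl_rotr _ _) _; apply: scl_sym.
apply: scl_trans (scl_rotr _ _) _; apply: scl_sym.
exact: scl_inside c01 e.
Qed.

Lemma scl_repeat_last u s : same_closed_line (u :: s) (rcons (u :: s) u).
Proof.
apply: scl_sym; rewrite -cats1; apply: scl_trans (scl_rotr _ _) _.
exact: scl_repeat.
Qed.

Section Stops.
(* The line [v] runs along the polygon [f]: it visits its vertices in order at
   the times selected by [fl], and [i] counts the vertices visited. *)
Variables (f v : nat -> 'rV[R]_n) (fl : nat -> bool) (i : nat -> nat).
Hypothesis iS : forall a, i a.+1 = (i a + fl a.+1)%N.
Hypothesis vE : forall a, fl a -> v a = f (i a).
Hypothesis between : forall a, exists2 c : R, 0 <= c <= 1 &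
  v a = (1 - c) *: f (i a) + c *: v a.+1.

(** Samples are treated from left to right: a vertex joins the prefix [s], any other sample is
    deleted as lying between the last vertex and the following sample. Ending at a vertex ensures
    that a following sample exists. *)
Lemma scl_stops len a s : fl (a + len)%N ->
  same_closed_line (s ++ f (i a) :: [seq v b | b <- iota a.+1 len])
    (s ++ f (i a) :: [seq f j | j <- iota (i a).+1 (i (a + len) - i a)%N]).
Proof.
elim: len a s => [|len IH] a s fa; first by rewrite addn0 subnn; apply: scl_refl.
have le_i b c : (i b <= i (b + c))%N.
  by elim: c => [|c h]; rewrite ?addn0 // addnS iS (leq_trans h) // leq_addr.
rewrite /=; have [fa1|fa1] := boolP (fl a.+1).
  have ia : i a.+1 = (i a).+1 by rewrite iS fa1 addn1.
  rewrite (vE fa1) ia -cat_rcons -ia; apply: scl_trans (IH _ _ _) _.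
    by rewrite addSnnS.
  rewrite cat_rcons addSnnS ia.
  have -> : (i (a + len.+1) - i a = (i (a + len.+1) - (i a).+1).+1)%N.
    by rewrite -subSn ?subSS // -ia -addSnnS le_i.
  by apply: scl_refl.
have ia : i a.+1 = i a by rewrite iS (negbTE fa1) addn0.
case: len IH fa => [|len] IH fa; first by rewrite addn1 (negbTE fa1) in fa.
have [c c01 e] := between a.+1; rewrite ia in e.
apply: scl_trans (scl_inside_cat _ _ c01 e) _.
by have := IH a.+1 s; rewrite addSnnS ia /=; apply.
Qed.

Lemma scl_stops_closed m a : (0 < m)%N -> fl a -> fl (a + m)%N ->
  v (a + m)%N = v a ->
  same_closed_line (mkseq (fun b => v (a + b)%N) m)
    (mkseq (fun j => f (i a + j)%N) (i (a + m) - i a)).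
Proof.
case: m => // m _ fa fm vm.
have fi : f (i (a + m.+1)) = f (i a) by rewrite -!vE.
have mapE (g : nat -> 'rV[R]_n) b len :
    mkseq (fun j => g (b + j)%N) len.+1 = g b :: [seq g j | j <- iota b.+1 len].
  rewrite /mkseq /= addn0; congr cons.
  by rewrite -[b.+1]addn1 iotaDl -map_comp.
have i0 : (i a < i (a + m.+1))%N.
  have le_i b c : (i b <= i (b + c))%N.
    by elim: c => [|c h]; rewrite ?addn0 // addnS iS (leq_trans h) // leq_addr.
  by rewrite addnS iS -addnS fm addn1 ltnS le_i.
rewrite -(prednK (_ : 0 < i (a + m.+1) - i a)%N) ?subn_gt0 //.
rewrite !mapE (vE fa).
(* Repeating the first vertex at the end of both closed lines brings them into the open form of
   [scl_stops]. *)
apply: scl_trans (scl_repeat_last _ _) _; apply: scl_sym.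
apply: scl_trans (scl_repeat_last _ _) _; apply: scl_sym.
have := scl_stops [::] fm.
rewrite -(prednK (_ : 0 < i (a + m.+1) - i a)%N) ?subn_gt0 //.
rewrite -[X in iota _ X]addn1 -[X in iota (i a).+1 X]addn1 !iotaD !map_cat /=.
rewrite !cats1 addSnnS vm (vE fa) addSnnS prednK ?subn_gt0 //.
by rewrite subnKC ?(ltnW i0) // fi.
Qed.

End Stops.

Lemma scl_mkseq_rot (v : nat -> 'rV[R]_n) a m : (forall b, v (b + m)%N = v b) ->
  same_closed_line (mkseq v m) (mkseq (fun b => v (a + b)%N) m).
Proof.
move=> vm; elim: a => [|a IH]; first exact: scl_refl.
apply: scl_trans IH _; case: m vm => [|m] vm; first exact: scl_refl.
have -> : mkseq (fun b => v (a + b)%N) m.+1 =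
    [:: v a] ++ mkseq (fun b => v (a.+1 + b)%N) m.
  rewrite (mkseqD _ 1 m) /mkseq /= addn0; congr cons.
  by apply: eq_map => b; rewrite addnA addn1.
have -> : mkseq (fun b => v (a.+1 + b)%N) m.+1 =
    mkseq (fun b => v (a.+1 + b)%N) m ++ [:: v a].
  by rewrite -[m.+1]addn1 mkseqD /mkseq /= addn0 addSnnS vm.
exact: scl_rotr.
Qed.

End ClosedLines.

(** * Merging two closed trajectories *)

Section Orbits.
Variables (R : realType) (n : nat) (N M : 'rV[R]_n -> R).
Hypothesis NM : hpair N M.
Let hN := hpair_norm NM.
Let hM := hpair_norm_dual NM.
Let K := [set x | N x <= 1].
Implicit Types z : nat -> 'rV[R]_n * 'rV[R]_n.

(** Slopes and multipliers are functions of the index, so that the multipliers can be summed and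
    serve as a clock. *)
Record orbit m z (a b : nat -> 'rV[R]_n) (lam mu : nat -> R) : Prop := Orbit {
  orbit_regular : forall i, regular_state N M (z i);
  orbit_a : forall i, locally_affine N (z i).1 (a i);
  orbit_b : forall i, locally_affine M (z i).2 (b i);
  orbit_lam : forall i, 0 < lam i;
  orbit_mu : forall i, 0 < mu i;
  orbit_p : forall i, (z i.+1).2 = (z i).2 - lam i *: a i;
  orbit_q : forall i, (z i.+1).1 = (z i).1 + mu i *: b i.+1;
  orbit_per : forall i, z (i + m)%N = z i;
  orbit_a_per : forall i, a (i + m)%N = a i;
  orbit_lam_per : forall i, lam (i + m)%N = lam i }.

Lemma smooth_normal x : smooth_point K x ->
  N x = 1 /\ locally_affine N x (outer_normal K x).
Proof.
by move=> /(smooth_point_laff hN) [x1 [a xa]]; rewrite (outer_normal_ball hN xa).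
Qed.

Lemma cycle_nth (T : Type) (e : rel T) x0 s i : cycle e s -> s <> [::] ->
  e (nth x0 s (i %% size s)) (nth x0 s (i.+1 %% size s)).
Proof.
case: s => // x s /= /(pathP x0) h _.
have im : (i %% (size s).+1 < (size s).+1)%N by rewrite ltn_pmod.
have := h (i %% (size s).+1)%N; rewrite size_rcons => /(_ im).
have -> : nth x0 (x :: rcons s x) (i %% (size s).+1) = nth x0 (x :: s) (i %% (size s).+1).
  by rewrite -rcons_cons nth_rcons /= im.
rewrite -[(i.+1)]addn1 -modnDml addn1; move: (i %% (size s).+1)%N im => j im.
move: im; rewrite ltnS leq_eqVlt => /orP[/eqP ->|im].
  by rewrite nth_rcons ltnn eqxx modnn.
by rewrite nth_rcons im modn_small.
Qed.

Lemma orbit_of_billiard Q : (0 < size Q)%N -> closed_billiard K (polar K) Q ->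
  exists a b lam mu, orbit (size Q) (fun i => nth 0 Q (i %% size Q)) a b lam mu.
Proof.
rewrite /K (hpair_polar NM) => Q0 [Qn smQ cyQ]; pose z i := nth 0 Q (i %% size Q).
have zQ i : z i \in Q by rewrite mem_nth // ltn_pmod.
have zper i : z (i + size Q)%N = z i by rewrite /z modnDr.
pose T := [set x | M x <= 1].
have sq i := smooth_normal (smQ _ (zQ i)).1.
have sp i : M (z i).2 = 1 /\ locally_affine M (z i).2 (outer_normal T (z i).2).
  have [p1 [b pb]] := smooth_point_laff hM (smQ _ (zQ i)).2.
  by rewrite /T (outer_normal_ball hM pb).
have st i : momentum_rule K (z i).1 (z i).2 (z i.+1).2 /\
    position_rule T (z i).1 (z i.+1).2 (z i.+1).1.
  by have := cycle_nth 0 i cyQ (elimN eqP Qn) => /asboolP.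
exists (fun i => outer_normal K (z i).1), (fun i => outer_normal T (z i).2).
(* Pairing the displacement with the base point of the normal recovers the multiplier, by a visibly
   periodic formula. *)
exists (fun i => dotp ((z i).2 - (z i.+1).2) (z i).1).
exists (fun i => dotp ((z i.+1).1 - (z i).1) (z i.+1).2).
have pE i : exists2 l, 0 < l & [/\ (z i.+1).2 = (z i).2 - l *: outer_normal K (z i).1
    & dotp ((z i).2 - (z i.+1).2) (z i).1 = l].
  have [[l l0 e] _] := st i; exists l => //.
  have e' : (z i.+1).2 = (z i).2 - l *: outer_normal K (z i).1.
    by rewrite -e addrC subrK.
  split=> //; rewrite -opprB e opprK dotpZl.
  by have [x1 xa] := sq i; rewrite (laff_dot hN xa) x1 mulr1.
have qE i : exists2 l, 0 < l & [/\ (z i.+1).1 = (z i).1 + l *: outer_normal T (z i.+1).2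
    & dotp ((z i.+1).1 - (z i).1) (z i.+1).2 = l].
  have [_ [l l0 e]] := st i; exists l => //.
  split; first by rewrite -e addrC subrK.
  rewrite e dotpZl.
  by have [x1 xa] := sp i.+1; rewrite (laff_dot hM xa) x1 mulr1.
split=> i.
- split; [exact: (sq i).1|exact: (sp i).1| |].
    by exists (outer_normal K (z i).1); exact: (sq i).2.
  by exists (outer_normal T (z i).2); exact: (sp i).2.
- exact: (sq i).2.
- exact: (sp i).2.
- by have [l l0 [_ ->]] := pE i.
- by have [l l0 [_ ->]] := qE i.
- by have [l l0 [e e']] := pE i; rewrite -/(z i) -/(z i.+1) e' -e.
- by have [l l0 [e e']] := qE i; rewrite -/(z i) -/(z i.+1) e' -e.
- exact: zper.
- exact: (congr1 (fun w => outer_normal K w.1) (zper i)).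
- by rewrite -addSn !zper.
Qed.

Lemma orbit_length m z a b lam mu : orbit m z a b lam mu ->
  n%:R * \sum_(i < m) lam i = 2 * m%:R.
Proof.
move=> o.
have tr c len : trace N M (z c) [seq z j | j <- iota c.+1 len]
    (\sum_(i < len) lam (c + i)%N).
  elim: len c => [|len IH] c /=.
    by split; [exact: (orbit_regular o)|rewrite big_ord0].
  exists (lam c), (mu c), (\sum_(i < len) lam (c.+1 + i)%N).
  split=> //; first exact: (orbit_regular o).
    exists (a c), (b c.+1); split; [exact: (orbit_a o)|exact: (orbit_b o)| | |].
    - exact: (orbit_p o).
    - exact: (orbit_q o).
    - by split; [exact: (orbit_lam o)|exact: (orbit_mu o)].
  rewrite big_ord_recl addn0; congr (_ + _).
  by apply: eq_bigr => i _; rewrite /= /bump /= addnA addn1.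
have := hpair_length_law NM (tr 0%N m); rewrite size_map size_iota; apply.
rewrite -[RHS](orbit_per o) add0n; case: (m) => // m'.
by rewrite -[m'.+1]addn1 iotaD map_cat last_cat /= add1n addn1.
Qed.

(** Uniqueness of the next point comes from [laff_inj_ray], whose slope condition holds because
    normals never pair to zero. *)
Lemma extension_of_bounces z : (forall i, regular_state N M (z i)) ->
  (forall i, exists lam mu, bounce N M (z i) lam mu (z i.+1)) ->
  billiard_extension K (polar K) z.
Proof.
have n0 := hpair_dim NM.
rewrite /K (hpair_polar NM) => reg bnc i.
have [q1 p1 [a0 qa0] [b0 pb0]] := reg i.
have [q1' p1' [a1 qa1] [b1 pb1]] := reg i.+1.
have [lam [mu [a [b [qa pb e1 e2 [l0 m0]]]]]] := bnc i.
split.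
- exact: (laff_smooth_point hN n0 q1 qa).
- rewrite /momentum_rule (outer_normal_ball hN qa) (boundary_ball hM); split.
    by split=> //; exists lam => //; rewrite e1 addrC addKr.
  move=> p' [[l l0' e'] /= p'1]; rewrite e1.
  have -> : p' = (z i).2 - l *: a by rewrite -e' addrC subrK.
  congr (_ - _ *: _).
  apply: (laff_inj_ray hM (v := - a) p1 pb0 _ l0 l0').
  - by rewrite dotpNr oppr_eq0 dotpC; exact: hpair_slopes_neq0 NM qa pb0.
  - by rewrite scalerN -e1.
  - by rewrite scalerN -e' addrC subrK.
- exact: (laff_smooth_point hM n0 p1' pb).
- rewrite /position_rule (outer_normal_ball hM pb) (boundary_ball hN); split.
    by split=> //; exists mu => //; rewrite e2 addrC addKr.
  move=> q' [[l l0' e'] /= q'1]; rewrite e2.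
  have -> : q' = (z i).1 + l *: b by rewrite -e' addrC subrK.
  congr (_ + _ *: _).
  apply: (laff_inj_ray hN (v := b) q1 qa _ m0 l0').
  - exact: hpair_slopes_neq0 NM qa pb.
  - by rewrite -e2.
  - by rewrite -e' addrC subrK.
Qed.

Lemma closed_of_bounces m z : (0 < m)%N -> (forall i, z (i + m)%N = z i) ->
  (forall i, regular_state N M (z i)) ->
  (forall i, exists lam mu, bounce N M (z i) lam mu (z i.+1)) ->
  closed_billiard K (polar K) (mkseq z m).
Proof.
move=> m0 zm reg bnc; have ext := extension_of_bounces reg bnc.
have smq i : smooth_point K (z i).1 by have [] := ext i.
(* The extension certifies momenta from index 1 on; periodicity covers index 0. *)
have smp i : smooth_point (polar K) (z i).2 by rewrite -zm -(prednK m0) addnS; have [] := ext (i + m.-1)%N.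
split.
- by case: (m) m0.
- by move=> w /mapP[i _ ->].
- have pth c len (e : rel ('rV[R]_n * 'rV[R]_n)) : (forall i, e (z i) (z i.+1)) ->
      path e (z c) [seq z j | j <- iota c.+1 len].
    by move=> h; elim: len c => //= len IH c; rewrite h IH.
  rewrite -(prednK m0) /mkseq /=.
  have -> : rcons [seq z i | i <- iota 1 m.-1] (z 0%N) = [seq z j | j <- iota 1 m].
    rewrite -[in RHS](prednK m0) -[m.-1.+1]addn1 iotaD map_cat cats1 /= add1n prednK //.
    by rewrite -(zm 0%N) add0n.
  apply: pth => i; apply/asboolP.
  by have [_ [[h1 _] _] _ [[h2 _] _]] := ext i.
Qed.

End Orbits.

(** * One orbit run through at sampled times *)

Section Component.
Variables (R : realType) (n : nat) (N M : 'rV[R]_n -> R).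
Hypothesis NM : hpair N M.
Variables (m1 : nat) (z : nat -> 'rV[R]_n * 'rV[R]_n).
Variables (a b : nat -> 'rV[R]_n) (lam mu : nat -> R).
Hypotheses (o : orbit N M m1 z a b lam mu) (m1_gt0 : (0 < m1)%N).

(* The orbit [z] is run through at unit speed along the sampling times [tim];
   [S i] is the instant at which its [i]-th momentum is reached, [idx] the index
   of the last one reached, and [fl] selects the samples which reach one. *)
Variables (S tim : nat -> R) (fl : nat -> bool) (idx : nat -> nat) (m : nat).
Hypotheses (SS : forall i, S i.+1 = S i + lam i)
  (idx0 : idx 0%N = 0%N)
  (idxS : forall i, idx i.+1 = (idx i + fl i.+1)%N)
  (tim_hit : forall i, fl i -> tim i = S (idx i))
  (tim_miss : forall i, ~~ fl i -> S (idx i) < tim i)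
  (tim_next : forall i, tim i < S (idx i).+1)
  (tim_lt : forall i, tim i < tim i.+1)
  (idx_per : forall i, idx (i + m)%N = (idx i + m1)%N)
  (fl_per : forall i, fl (i + m)%N = fl i)
  (tim_per : forall i, tim (i + m)%N - S (idx (i + m)%N) = tim i - S (idx i)).

Definition run_p i := (z (idx i)).2 - (tim i - S (idx i)) *: a (idx i).

Lemma run_p_hit i : fl i -> run_p i = (z (idx i)).2.
Proof. by move=> fi; rewrite /run_p tim_hit // subrr scale0r subr0. Qed.

(** Even when the next sample is a hit it lies on the current edge, as its end point. *)
Lemma run_p_line i : run_p i.+1 = (z (idx i)).2 - (tim i.+1 - S (idx i)) *: a (idx i).
Proof.
have [fi|fi] := boolP (fl i.+1); last by rewrite /run_p idxS (negbTE fi) addn0.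
rewrite run_p_hit // tim_hit // idxS fi addn1 (orbit_p o) SS.
by rewrite addrAC subrr add0r.
Qed.

Lemma run_pS i : run_p i.+1 = run_p i - (tim i.+1 - tim i) *: a (idx i).
Proof. by rewrite run_p_line /run_p; apply/rowP => j; rewrite !mxE; ring. Qed.

Lemma run_p_miss i : ~~ fl i -> M (run_p i) < 1.
Proof.
move=> fi; rewrite /run_p -scalerN.
apply: (laff_lt1_ray (hpair_norm_dual NM) (b := b (idx i)) (s := lam (idx i))).
- by have [] := orbit_regular o (idx i).
- exact: (orbit_b o).
- rewrite dotpNr oppr_eq0 dotpC.
  exact: hpair_slopes_neq0 NM (orbit_a o _) (orbit_b o _).
- by rewrite scalerN -(orbit_p o); have [] := orbit_regular o (idx i).+1.
- by have := tim_miss fi; have := tim_next i; rewrite SS => ? ?; apply/andP; split; lra.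
Qed.

Lemma run_p_per i : run_p (i + m) = run_p i.
Proof. by rewrite /run_p tim_per idx_per (orbit_per o) (orbit_a_per o). Qed.

(** The index is unbounded and grows by at most one per step, so each positive value is attained
    first at a hit; the value 0 is there from the start. *)
Lemma idx_reach i : (0 < i)%N -> exists2 j, fl j & idx j = i.
Proof.
have big c : (c <= idx (c * m))%N.
  by elim: c => // c IH; rewrite mulSnr idx_per -addn1 leq_add.
move=> i0; have := big i; elim: (i * m)%N => [|j IH].
  by rewrite idx0 leqNgt i0.
have [/IH //|lt] := leqP i (idx j).
rewrite idxS => le; have fj : fl j.+1 by move: le; case: (fl _); rewrite // addn0 leqNgt lt.
exists j.+1 => //; apply/eqP; rewrite eqn_leq idxS; apply/andP; split=> //.
by rewrite fj addn1.
Qed.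

(** The comparison of lines must begin at a hit, so both sequences are first rotated to one. *)
Lemma run_line (f v : nat -> 'rV[R]_n) : (forall i, v (i + m)%N = v i) ->
  (forall i, f (i + m1)%N = f i) -> (forall i, fl i -> v i = f (idx i)) ->
  (forall i, exists2 c : R, 0 <= c <= 1 &
     v i = (1 - c) *: f (idx i) + c *: v i.+1) ->
  same_closed_line (mkseq v m) (mkseq f m1).
Proof.
move=> vper fper vE bt; have [i fi _] := idx_reach (ltn0Sn 0).
have m0 : (0 < m)%N.
  by case: (m) idx_per => // /(_ 0%N); rewrite addn0 idx0 => e; move: m1_gt0; rewrite -[m1]add0n -e.
apply: scl_trans (scl_mkseq_rot i vper) _.
have := @scl_stops_closed _ _ f v fl idx idxS vE bt m i m0 fi.
rewrite fl_per vper idx_per addKn => /(_ fi erefl) h; apply: scl_trans h _.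
by apply: scl_sym; exact: scl_mkseq_rot.
Qed.

Lemma run_line_q (c : R) : same_closed_line
  (mkseq (fun i => c *: (z (idx i)).1) m) (mkseq (fun i => c *: (z i).1) m1).
Proof.
apply: run_line => i //.
- by rewrite idx_per (orbit_per o).
- by rewrite (orbit_per o).
- by exists 0; rewrite ?lexx ?ler01 // subr0 scale1r scale0r addr0.
Qed.

Lemma run_line_p : same_closed_line (mkseq run_p m) (mkseq (fun i => (z i).2) m1).
Proof.
apply: run_line => i; first exact: run_p_per.
- by rewrite (orbit_per o).
- exact: run_p_hit.
have le : S (idx i) <= tim i.
  by have [fi|/tim_miss/ltW //] := boolP (fl i); rewrite tim_hit.
have lt := tim_lt i.
(* The weight is the fraction elapsed of the time from the last vertex to the next sample. *)
exists ((tim i - S (idx i)) / (tim i.+1 - S (idx i))).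
  by rewrite divr_ge0 /= ?ler_pdivrMr; lra.
rewrite run_p_line /run_p; apply/rowP => j; rewrite !mxE; field.
by apply/eqP; lra.
Qed.

(** A shift by [d] that preserves hits and vertices advances the index by [idx d]; [r] such shifts
    make up [m1], so the orbit itself would be a repetition. *)
Lemma run_simple : simple_cycle (mkseq z m1) -> forall d r, (1 < r)%N ->
  (r * d)%N = m -> (forall i, fl (i + d)%N = fl i) ->
  (forall i, fl i -> z (idx (i + d)%N) = z (idx i)) -> False.
Proof.
move=> simp d r r1 rd fld zd; apply: simp.
have idxd i : idx (i + d)%N = (idx i + idx d)%N.
  elim: i => [|i IH]; first by rewrite idx0.
  by rewrite addSn !idxS -addSn fld IH addnAC.
have re : (r * idx d)%N = m1.
  have -> : m1 = idx m by rewrite -(add0n m) idx_per idx0.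
  rewrite -rd; elim: (r) => [|r' IH]; first by rewrite !mul0n idx0.
  by rewrite !mulSnr idxd IH.
exists (mkseq z (idx d)), r; split=> //; rewrite -re; apply: mkseq_flatten.
have zpos i : (0 < i)%N -> z (i + idx d)%N = z i.
  by move=> /idx_reach [j fj <-]; rewrite -idxd zd.
(* Index 0 need not come from a hit, so it is replaced by [m1]. *)
case=> [|i]; last exact: zpos.
by rewrite -(orbit_per o) addnAC add0n zpos // -(orbit_per o 0%N).
Qed.

End Component.

(** * Merging two periodic sequences of events *)

Section Schedule.
Variables (R : realType) (S1 S2 : nat -> R) (m1 m2 : nat) (P : R).
Hypotheses (S1_lt : forall i, S1 i < S1 i.+1) (S2_lt : forall i, S2 i < S2 i.+1)
  (S1_per : forall i, S1 (i + m1)%N = S1 i + P)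
  (S2_per : forall i, S2 (i + m2)%N = S2 i + P)
  (S12 : forall i j, S1 i != S2 j) (S1_0 : S1 0%N < S2 0%N) (S2_0 : S2 0%N < S1 1%N).

(* The merger of the two increasing sequences: after [n] steps, the last events
   seen are [S1 i] and [S2 j] with [(i, j) = sched n]. *)
Fixpoint sched n : nat * nat :=
  if n is n'.+1 then
    if S1 (sched n').1.+1 < S2 (sched n').2.+1
    then ((sched n').1.+1, (sched n').2) else ((sched n').1, (sched n').2.+1)
  else (0%N, 0%N).

Definition sched_time n := Num.max (S1 (sched n).1) (S2 (sched n).2).
Definition sched_fst n := S2 (sched n).2 < S1 (sched n).1.

Lemma sched_inv n : S1 (sched n).1 < S2 (sched n).2.+1 /\
  S2 (sched n).2 < S1 (sched n).1.+1.
Proof.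
elim: n => [|n [IH1 IH2]] /=; first by split=> //; exact: lt_trans S1_0 (S2_lt 0).
case: (ltP (S1 (sched n).1.+1)) => [lt|] /=; first by split=> //; apply: (lt_trans IH2); exact: S1_lt.
rewrite le_eqVlt eq_sym (negbTE (S12 _ _)) /= => lt.
by split=> //; exact: lt_trans IH1 (S2_lt _).
Qed.

Lemma sched_step n :
  (sched n.+1).1 = ((sched n).1 + sched_fst n.+1)%N /\
  (sched n.+1).2 = ((sched n).2 + ~~ sched_fst n.+1)%N.
Proof.
have [i1 i2] := sched_inv n; rewrite /sched_fst /=.
case: ifP => _ /=; first by rewrite i2 addn1 addn0.
by rewrite ltNge (ltW i1) addn0 addn1.
Qed.

Lemma sched_time_fst n : sched_fst n -> sched_time n = S1 (sched n).1.
Proof. by rewrite /sched_fst /sched_time => /ltW /max_idPl. Qed.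

Lemma sched_time_snd n : ~~ sched_fst n -> sched_time n = S2 (sched n).2.
Proof. by rewrite /sched_fst /sched_time -leNgt => /max_idPr. Qed.

Lemma sched_miss_snd n : sched_fst n -> S2 (sched n).2 < sched_time n.
Proof. by move=> h; rewrite sched_time_fst. Qed.

Lemma sched_miss_fst n : ~~ sched_fst n -> S1 (sched n).1 < sched_time n.
Proof.
move=> h; rewrite sched_time_snd //; move: h; rewrite /sched_fst -leNgt le_eqVlt.
by rewrite (negbTE (S12 _ _)).
Qed.

Lemma sched_next1 n : sched_time n < S1 (sched n).1.+1.
Proof. by rewrite gt_max S1_lt; case: (sched_inv n). Qed.

Lemma sched_next2 n : sched_time n < S2 (sched n).2.+1.
Proof. by rewrite gt_max S2_lt andbT; case: (sched_inv n). Qed.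

Lemma sched_time_lt n : sched_time n < sched_time n.+1.
Proof.
have [e1 e2] := sched_step n; have [h|h] := boolP (sched_fst n.+1).
  by rewrite (sched_time_fst h) e1 h addn1 sched_next1.
by rewrite (sched_time_snd h) e2 h addn1 sched_next2.
Qed.

(** The indices at step [n] add up to [n], and the interleaving of [sched_inv] allows only one pair
    with a given sum. The shifted pair is interleaved too, because both sequences gain [P] per
    period. *)
Lemma sched_per n :
  sched (n + (m1 + m2)) = ((sched n).1 + m1, (sched n).2 + m2)%N.
Proof.
have sum c : ((sched c).1 + (sched c).2 = c)%N.
  elim: c => // c IH; have [-> ->] := sched_step c.
  by rewrite addnACA IH (addnC (_ : bool)) addn_negb addn1.
have mono (S : nat -> R) : (forall i, S i < S i.+1) -> {homo S : i j / (i <= j)%N >-> i <= j}.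
  by move=> h; apply/nondecreasing_seqP => i; exact: ltW.
have := sum n; have := sched_inv n; have := sum (n + (m1 + m2))%N.
have := sched_inv (n + (m1 + m2)).
case: (sched (n + (m1 + m2))) => i' j' /= [v1 v2] e'.
case: (sched n) => i j /= [u1 u2] e.
have {}u1 : S1 (i + m1)%N < S2 (j + m2).+1 by rewrite -addSn S1_per S2_per ltrD2r.
have {}u2 : S2 (j + m2)%N < S1 (i + m1).+1 by rewrite -addSn S1_per S2_per ltrD2r.
have {e e'} e : (i' + j' = (i + m1) + (j + m2))%N by rewrite e' -e addnACA.
have ii : i' = (i + m1)%N; last first.
  by move: e; rewrite ii => /addnI ->.
move: (i + m1)%N (j + m2)%N u1 u2 e => {}i {}j u1 u2 e.
(* If one index were smaller the other would be larger, and the interleaving inequalities would form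
   a cycle. *)
case: (ltngtP i' i) => // lt; exfalso.
- have lj : (j < j')%N by rewrite ltnNge; apply/negP => le; move: (leq_add lt le); rewrite addSn e ltnn.
  have := mono _ S1_lt _ _ lt; have := mono _ S2_lt _ _ lj; lra.
- have lj : (j' < j)%N by rewrite ltnNge; apply/negP => le; move: (leq_add lt le); rewrite addSn -e ltnn.
  have := mono _ S1_lt _ _ lt; have := mono _ S2_lt _ _ lj; lra.
Qed.

Lemma sched_fst_per n : sched_fst (n + (m1 + m2)) = sched_fst n.
Proof. by rewrite /sched_fst sched_per /= S1_per S2_per ltrD2r. Qed.

Lemma sched_time_per n : sched_time (n + (m1 + m2)) = sched_time n + P.
Proof. by rewrite /sched_time sched_per /= S1_per S2_per addr_maxl. Qed.

End Schedule.

(** * The merged trajectory *)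

Section Merge.
Variables (R : realType) (k l : nat).
Variables (N1 M1 : 'rV[R]_k -> R) (N2 M2 : 'rV[R]_l -> R).
Hypotheses (h1 : hpair N1 M1) (h2 : hpair N2 M2).
Variables (m1 m2 : nat) (z1 : nat -> 'rV[R]_k * 'rV[R]_k)
  (z2 : nat -> 'rV[R]_l * 'rV[R]_l).
Variables (a1 b1 : nat -> 'rV[R]_k) (lam1 mu1 : nat -> R).
Variables (a2 b2 : nat -> 'rV[R]_l) (lam2 mu2 : nat -> R).
Hypotheses (o1 : orbit N1 M1 m1 z1 a1 b1 lam1 mu1)
  (o2 : orbit N2 M2 m2 z2 a2 b2 lam2 mu2) (m1_gt0 : (0 < m1)%N) (m2_gt0 : (0 < m2)%N).
Variables (S1 S2 : nat -> R) (P alpha : R).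
Hypotheses (S1S : forall i, S1 i.+1 = S1 i + lam1 i)
  (S2S : forall i, S2 i.+1 = S2 i + lam2 i)
  (S1_per : forall i, S1 (i + m1)%N = S1 i + P)
  (S2_per : forall i, S2 (i + m2)%N = S2 i + P)
  (S12 : forall i j, S1 i != S2 j) (S1_0 : S1 0%N < S2 0%N) (S2_0 : S2 0%N < S1 1%N)
  (alpha01 : 0 < alpha < 1).

Let N := sumN N1 N2.
Let M := maxN M1 M2.
Let H := [set x | N x <= 1].
Let n1 := hpair_norm h1.
Let n2 := hpair_norm h2.
Let d1 := hpair_norm_dual h1.
Let d2 := hpair_norm_dual h2.
Let m := (m1 + m2)%N.
Let idx1 i := (sched S1 S2 i).1.
Let idx2 i := (sched S1 S2 i).2.
Let tim := sched_time S1 S2.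
Let fl1 := sched_fst S1 S2.
Let fl2 i := ~~ fl1 i.
Let p1 := run_p z1 a1 S1 tim idx1.
Let p2 := run_p z2 a2 S2 tim idx2.

Let S1_lt i : S1 i < S1 i.+1. Proof. by rewrite S1S ltrDl (orbit_lam o1). Qed.
Let S2_lt i : S2 i < S2 i.+1. Proof. by rewrite S2S ltrDl (orbit_lam o2). Qed.
Let idx1S i : idx1 i.+1 = (idx1 i + fl1 i.+1)%N.
Proof. by have [] := sched_step S1_lt S2_lt S12 S1_0 S2_0 i. Qed.
Let idx2S i : idx2 i.+1 = (idx2 i + fl2 i.+1)%N.
Proof. by have [] := sched_step S1_lt S2_lt S12 S1_0 S2_0 i. Qed.
Let tim1 i : fl1 i -> tim i = S1 (idx1 i). Proof. exact: sched_time_fst. Qed.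
Let tim2 i : fl2 i -> tim i = S2 (idx2 i). Proof. exact: sched_time_snd. Qed.
Let miss1 i : ~~ fl1 i -> S1 (idx1 i) < tim i. Proof. exact: sched_miss_fst. Qed.
Let miss2 i : ~~ fl2 i -> S2 (idx2 i) < tim i.
Proof. by rewrite negbK; exact: sched_miss_snd. Qed.
Let next1 i : tim i < S1 (idx1 i).+1. Proof. exact: sched_next1. Qed.
Let next2 i : tim i < S2 (idx2 i).+1. Proof. exact: sched_next2. Qed.
Let tim_lt i : tim i < tim i.+1. Proof. exact: sched_time_lt. Qed.
Let sper := sched_per S1_lt S2_lt S1_per S2_per S12 S1_0 S2_0.
Let per1 i : idx1 (i + m)%N = (idx1 i + m1)%N. Proof. by rewrite /idx1 sper. Qed.
Let per2 i : idx2 (i + m)%N = (idx2 i + m2)%N. Proof. by rewrite /idx2 sper. Qed.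
Let flper i : fl1 (i + m)%N = fl1 i.
Proof. exact: (sched_fst_per S1_lt S2_lt S1_per S2_per S12 S1_0 S2_0). Qed.
Let flper2 i : fl2 (i + m)%N = fl2 i. Proof. by rewrite /fl2 flper. Qed.
Let tper i : tim (i + m)%N = tim i + P.
Proof. exact: (sched_time_per S1_lt S2_lt S1_per S2_per S12 S1_0 S2_0). Qed.
Let tper1 i : tim (i + m)%N - S1 (idx1 (i + m)%N) = tim i - S1 (idx1 i).
Proof. by rewrite tper per1 S1_per; ring. Qed.
Let tper2 i : tim (i + m)%N - S2 (idx2 (i + m)%N) = tim i - S2 (idx2 i).
Proof. by rewrite tper per2 S2_per; ring. Qed.

Definition merged i : 'rV[R]_(k + l) * 'rV[R]_(k + l) :=
  (row_mx (alpha *: (z1 (idx1 i)).1) ((1 - alpha) *: (z2 (idx2 i)).1),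
   row_mx (p1 i) (p2 i)).

Lemma merged_slope i :
  locally_affine N (merged i).1 (row_mx (a1 (idx1 i)) (a2 (idx2 i))).
Proof.
have /andP[al0 al1] := alpha01.
apply/(laff_sum n1 n2); rewrite !row_mxKl !row_mxKr; split.
  by apply: laff_scale => //; exact: (orbit_a o1).
by apply: laff_scale; [| lra |exact: (orbit_a o2)].
Qed.

(** Events never coincide, so when the first block reaches a vertex the second is inside its ball,
    and the maximum is locally the first norm. *)
Lemma merged_p1_hit i : fl1 i -> [/\ M1 (p1 i) = 1, M2 (p2 i) < 1 &
  locally_affine M (merged i).2 (row_mx (b1 (idx1 i)) 0)].
Proof.
move=> fi; have e : p1 i = (z1 (idx1 i)).2 := run_p_hit _ _ tim1 fi.
have lt : M2 (p2 i) < 1.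
  by apply: (run_p_miss h2 o2 S2S miss2 next2); rewrite negbK.
have e1 : M1 (p1 i) = 1 by rewrite e; have [] := orbit_regular o1 (idx1 i).
split=> //; apply: (laff_maxl d1 d2); rewrite row_mxKl ?row_mxKr ?e1 //.
by rewrite e; exact: (orbit_b o1).
Qed.

Lemma merged_p2_hit i : fl2 i -> [/\ M2 (p2 i) = 1, M1 (p1 i) < 1 &
  locally_affine M (merged i).2 (row_mx 0 (b2 (idx2 i)))].
Proof.
move=> fi; have e : p2 i = (z2 (idx2 i)).2 := run_p_hit _ _ tim2 fi.
have lt : M1 (p1 i) < 1 by apply: (run_p_miss h1 o1 S1S miss1 next1).
have e1 : M2 (p2 i) = 1 by rewrite e; have [] := orbit_regular o2 (idx2 i).
split=> //; apply: (laff_maxr d1 d2); rewrite row_mxKr ?row_mxKl ?e1 //.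
by rewrite e; exact: (orbit_b o2).
Qed.

Lemma merged_regular i : regular_state N M (merged i).
Proof.
have /andP[al0 al1] := alpha01.
have [q1 _ _ _] := orbit_regular o1 (idx1 i).
have [q2 _ _ _] := orbit_regular o2 (idx2 i).
split.
- rewrite /N /sumN row_mxKl row_mxKr (normZ n1) (normZ n2) q1 q2 !gtr0_norm; lra.
- rewrite /M /maxN row_mxKl row_mxKr; have [fi|fi] := boolP (fl1 i).
    by have [-> lt _] := merged_p1_hit fi; rewrite max_l // ltW.
  by have [-> lt _] := merged_p2_hit fi; rewrite max_r // ltW.
- by eexists; exact: merged_slope.
- have [fi|fi] := boolP (fl1 i).
    by have [_ _ h] := merged_p1_hit fi; eexists; exact: h.
  by have [_ _ h] := merged_p2_hit fi; eexists; exact: h.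
Qed.

(** The momentum multiplier is the elapsed time; the position multiplier is that of the block that
    hits, scaled with the block. *)
Lemma merged_bounce i : exists lam mu, bounce N M (merged i) lam mu (merged i.+1).
Proof.
have /andP[al0 al1] := alpha01.
have pE : (merged i.+1).2 = (merged i).2 -
    (tim i.+1 - tim i) *: row_mx (a1 (idx1 i)) (a2 (idx2 i)).
  rewrite /merged /= scale_row_mx opp_row_mx add_row_mx; congr row_mx.
    exact: (run_pS o1 S1S idx1S tim1).
  exact: (run_pS o2 S2S idx2S tim2).
have t0 : 0 < tim i.+1 - tim i by rewrite subr_gt0.
exists (tim i.+1 - tim i); have [fi|fi] := boolP (fl1 i.+1).
- have [_ _ hb] := merged_p1_hit fi.
  exists (alpha * mu1 (idx1 i)), (row_mx (a1 (idx1 i)) (a2 (idx2 i))).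
  exists (row_mx (b1 (idx1 i.+1)) 0); split=> //; first exact: merged_slope.
    rewrite /merged /= idx1S idx2S /fl2 fi addn1 addn0 scale_row_mx add_row_mx.
    by rewrite (orbit_q o1) scalerDr scalerA scaler0 addr0.
  by split=> //; rewrite mulr_gt0 // (orbit_mu o1).
- have [_ _ hb] := merged_p2_hit fi.
  exists ((1 - alpha) * mu2 (idx2 i)), (row_mx (a1 (idx1 i)) (a2 (idx2 i))).
  exists (row_mx 0 (b2 (idx2 i.+1))); split=> //; first exact: merged_slope.
    rewrite /merged /= idx1S idx2S /fl2 (negbTE fi) addn1 addn0 scale_row_mx add_row_mx.
    by rewrite (orbit_q o2) scalerDr scalerA scaler0 addr0.
  by split=> //; rewrite mulr_gt0 ?(orbit_mu o2) //; lra.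
Qed.

Lemma merged_per i : merged (i + m) = merged i.
Proof.
rewrite /merged per1 per2 (orbit_per o1) (orbit_per o2).
by rewrite /p1 (run_p_per o1 per1 tper1) /p2 (run_p_per o2 per2 tper2).
Qed.

(** The kind of event is visible in the state, so a period of the states is one of the schedule. *)
Lemma merged_fl i : fl1 i = (M2 (rsubmx (merged i).2) < M1 (lsubmx (merged i).2)).
Proof.
rewrite row_mxKl row_mxKr; have [fi|fi] := boolP (fl1 i).
  by have [-> -> _] := merged_p1_hit fi.
by have [-> lt _] := merged_p2_hit fi; rewrite ltNge (ltW lt).
Qed.

Lemma merged_simple : simple_cycle (mkseq z1 m1) -> simple_cycle (mkseq merged m).
Proof.
move=> simp [t [r [r1 e]]].
have m0 : (0 < m)%N by rewrite addn_gt0 m1_gt0.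
have zt := flatten_period merged_per m0 e.
have rt : (r * size t)%N = m by rewrite -(size_mkseq merged m) e size_flatten_nseq.
have fd i : fl1 (i + size t)%N = fl1 i by rewrite !merged_fl zt.
apply: (run_simple o1 m1_gt0 erefl idx1S per1 simp r1 rt fd) => i fi.
have /andP[al0 al1] := alpha01.
have [e1 e2] : p1 (i + size t) = p1 i /\ (z1 (idx1 (i + size t)%N)).1 = (z1 (idx1 i)).1.
  have := zt i; rewrite /merged => -[/eq_row_mx [eq1 _] /eq_row_mx [eq2 _]].
  by split=> //; apply: (scalerI _ eq1); rewrite gt_eqF.
move: e1; rewrite /p1 !(run_p_hit _ _ tim1) ?fd // => e1.
by rewrite [LHS]surjective_pairing e1 e2 -surjective_pairing.
Qed.

Lemma merged_lines :
  [/\ congruent_closed_line [seq lsubmx x.1 | x <- mkseq merged m]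
        (mkseq (fun i => alpha *: (z1 i).1) m1),
      congruent_closed_line [seq rsubmx x.1 | x <- mkseq merged m]
        (mkseq (fun i => (1 - alpha) *: (z2 i).1) m2),
      same_closed_line [seq lsubmx x.2 | x <- mkseq merged m]
        (mkseq (fun i => (z1 i).2) m1) &
      same_closed_line [seq rsubmx x.2 | x <- mkseq merged m]
        (mkseq (fun i => (z2 i).2) m2)].
Proof.
have E (T : Type) (f : 'rV[R]_(k + l) * 'rV[R]_(k + l) -> T) g :
    (forall i, f (merged i) = g i) -> [seq f x | x <- mkseq merged m] = mkseq g m.
  by move=> h; rewrite /mkseq -map_comp; apply: eq_map => i; exact: h.
split.
(* The identity serves as the congruence: the projected line is the scaled line itself. *)
- exists id => [//|]; rewrite map_id.
  rewrite (E _ _ (fun i => alpha *: (z1 (idx1 i)).1)) => [|i]; last by rewrite row_mxKl.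
  exact: (run_line_q o1 m1_gt0 erefl idx1S per1 flper).
- exists id => [//|]; rewrite map_id.
  rewrite (E _ _ (fun i => (1 - alpha) *: (z2 (idx2 i)).1)) => [|i]; last by rewrite row_mxKr.
  exact: (run_line_q o2 m2_gt0 erefl idx2S per2 flper2).
- rewrite (E _ _ p1) => [|i]; last by rewrite row_mxKl.
  exact: (run_line_p o1 m1_gt0 S1S erefl idx1S tim1 miss1 tim_lt per1 flper tper1).
- rewrite (E _ _ p2) => [|i]; last by rewrite row_mxKr.
  exact: (run_line_p o2 m2_gt0 S2S erefl idx2S tim2 miss2 tim_lt per2 flper2 tper2).
Qed.

End Merge.

(** * Exceptional parameters and the final assembly *)

Lemma ae_avoid_countable (R : realType) (f : nat * nat -> R) :
  {ae (@lebesgue_measure R), forall x : R, forall ij, x != f ij}.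
Proof.
have cf : countable (range f).
  by apply: (card_le_trans (card_image_le f _)); exact: countableP.
exists (range f); split.
- by apply: countable_measurable => // x _; exact: measurable_set1.
- exact: countable_lebesgue_measure0.
- move=> x /= nx; apply: contrapT => fx; apply: nx => ij.
  by apply/eqP => e; apply: fx; exists ij.
Qed.

Section PartialSums.
Variables (R : realType) (k m : nat) (N M : 'rV[R]_k -> R).
Variables (z : nat -> 'rV[R]_k * 'rV[R]_k) (a b : nat -> 'rV[R]_k) (lam mu : nat -> R).
Hypotheses (NM : hpair N M) (o : orbit N M m z a b lam mu) (mk : m = (2 * k)%N).

(** For [m = 2k] the length law reads [k T = 4k]. *)
Lemma orbit_length4 i :
  \sum_(j < i + m) lam j = \sum_(j < i) lam j + 4 :> R.
Proof.
elim: i => [|i IH].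
  rewrite add0n big_ord0 add0r; have := orbit_length NM o.
  have k0 : k%:R != 0 :> R by rewrite pnatr_eq0 -lt0n (hpair_dim NM).
  have -> : m%:R = 2 * k%:R :> R by rewrite mk natrM.
  move=> e; apply: (mulfI k0); rewrite e; ring.
by rewrite addSn !big_ord_recr /= IH (orbit_lam_per o) addrAC.
Qed.

End PartialSums.

Theorem theorem3p5 (R : realType) (k l : nat)
  (K : set 'rV[R]_k) (L : set 'rV[R]_l)
  (Q1 : seq ('rV[R]_k * 'rV[R]_k)) (Q2 : seq ('rV[R]_l * 'rV[R]_l))
  (hK : hanner K) (hL : hanner L)
  (size1 : size Q1 = (2 * k)%N) (size2 : size Q2 = (2 * l)%N)
  (closed1 : closed_billiard K (polar K) Q1) (simple1 : simple_cycle Q1)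
  (closed2 : closed_billiard L (polar L) Q2) (simple2 : simple_cycle Q2) :
  let H := sum1 K L in
  forall alpha : R, 0 < alpha < 1 ->
  {ae (@lebesgue_measure R), forall beta : R, 0 < beta < 1 ->
    exists (z : nat -> 'rV[R]_(k + l) * 'rV[R]_(k + l)) (m : nat),
    let s := mkseq z m in
    [/\ z 0%N =
          (row_mx (alpha *: (nth 0 Q1 0).1) ((1 - alpha) *: (nth 0 Q2 0).1),
           row_mx (beta *: (nth 0 Q1 0).2 + (1 - beta) *: (nth 0 Q1 1).2)
                  (nth 0 Q2 0).2),
        billiard_extension H (polar H) z,
        forall i, z (i + m)%N = z i,
        closed_billiard H (polar H) s /\ simple_cycle s &
        [/\ congruent_closed_line [seq lsubmx x.1 | x <- s]
              [seq alpha *: x.1 | x <- Q1],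
            congruent_closed_line [seq rsubmx x.1 | x <- s]
              [seq (1 - alpha) *: x.1 | x <- Q2],
            same_closed_line [seq lsubmx x.2 | x <- s] [seq x.2 | x <- Q1] &
            same_closed_line [seq rsubmx x.2 | x <- s] [seq x.2 | x <- Q2]]]}.
Proof.
move=> H alpha alpha01.
have [N1 [M1 [h1 KE]]] := hanner_hpair hK.
have [N2 [M2 [h2 LE]]] := hanner_hpair hL.
have HE : H = [set x | sumN N1 N2 x <= 1].
  by rewrite /H /sum1 KE LE (gauge_ball (hpair_norm h1)) (gauge_ball (hpair_norm h2)).
have hH := hpair_sum h1 h2.
have Q1_gt0 : (0 < size Q1)%N by rewrite size1 muln_gt0 (hpair_dim h1).
have Q1_gt1 : (1 < size Q1)%N.
  by rewrite size1 (leq_trans (_ : 1 < 2 * 1)%N) // leq_mul2l (hpair_dim h1).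
have Q2_gt0 : (0 < size Q2)%N by rewrite size2 muln_gt0 (hpair_dim h2).
rewrite KE in closed1; rewrite LE in closed2.
have [a1 [b1 [lam1 [mu1 o1]]]] := orbit_of_billiard h1 Q1_gt0 closed1.
have [a2 [b2 [lam2 [mu2 o2]]]] := orbit_of_billiard h2 Q2_gt0 closed2.
set z1 := (fun i => nth 0 Q1 _) in o1; set z2 := (fun i => nth 0 Q2 _) in o2.
have z1E (T : Type) (f : 'rV[R]_k * 'rV[R]_k -> T) :
    [seq f x | x <- Q1] = mkseq (fun i => f (z1 i)) (size Q1).
  rewrite -[Q1 in LHS](mkseq_nth 0) /mkseq -map_comp.
  by apply/eq_in_map => i; rewrite mem_iota /= => iQ; rewrite /z1 modn_small.
have z2E (T : Type) (f : 'rV[R]_l * 'rV[R]_l -> T) :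
    [seq f x | x <- Q2] = mkseq (fun i => f (z2 i)) (size Q2).
  rewrite -[Q2 in LHS](mkseq_nth 0) /mkseq -map_comp.
  by apply/eq_in_map => i; rewrite mem_iota /= => iQ; rewrite /z2 modn_small.
pose T1 i := \sum_(j < i) lam1 j; pose T2 i := \sum_(j < i) lam2 j.
have lam0 := orbit_lam o1 0.
(* The excluded values are the solutions [beta] of [S1 i = T2 j], with the clock [S1] introduced
   below. *)
have [B [mB B0 hB]] :=
  ae_avoid_countable (fun ij => 1 - (T1 ij.1 - T2 ij.2) / lam1 0%N).
exists B; split=> // beta; apply: contra_notP => nB.
have good ij : beta != 1 - (T1 ij.1 - T2 ij.2) / lam1 0%N.
  by move: ij; apply: contrapT => nij; exact/nB/hB.
move=> /andP[beta0 beta1].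
(* The initial momentum is at the fraction [1 - beta] of the first edge, so the first block starts
   with the time [tau] already elapsed on it. *)
pose tau := (1 - beta) * lam1 0%N.
have tau0 : 0 < tau by rewrite mulr_gt0 // subr_gt0.
have tau1 : tau < lam1 0%N by rewrite /tau gtr_pMl //; lra.
pose S1 i := T1 i - tau.
have T1S i : T1 i.+1 = T1 i + lam1 i by rewrite /T1 big_ord_recr.
have T2S i : T2 i.+1 = T2 i + lam2 i by rewrite /T2 big_ord_recr.
have T10 : T1 0%N = 0 by rewrite /T1 big_ord0.
have T20 : T2 0%N = 0 by rewrite /T2 big_ord0.
have S1S i : S1 i.+1 = S1 i + lam1 i by rewrite /S1 T1S addrAC.
have S1_per i : S1 (i + size Q1)%N = S1 i + 4.
  by rewrite /S1 /T1 (orbit_length4 h1 o1 size1) addrAC.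
have T2_per i : T2 (i + size Q2)%N = T2 i + 4.
  by rewrite /T2 (orbit_length4 h2 o2 size2).
have S12 i j : S1 i != T2 j.
  apply: contra (good (i, j)) => /eqP e /=; apply/eqP.
  rewrite -e /S1 /tau; field; rewrite gt_eqF //.
have S1_0 : S1 0%N < T2 0%N by rewrite T20 /S1 T10; lra.
have T2_0 : T2 0%N < S1 1%N by rewrite T20 /S1 T1S T10; lra.
pose z := merged z1 z2 a1 a2 S1 T2 alpha.
pose m := (size Q1 + size Q2)%N.
have m0 : (0 < m)%N by rewrite addn_gt0 Q1_gt0.
have zper : forall i, z (i + m)%N = z i.
  exact: (merged_per o1 o2 alpha S1S T2S S1_per T2_per S12 S1_0 T2_0).
have reg : forall i, regular_state (sumN N1 N2) (maxN M1 M2) (z i).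
  exact: (merged_regular h1 h2 o1 o2 S1S T2S S12 S1_0 T2_0 alpha01).
have bnc : forall i, exists lam mu,
    bounce (sumN N1 N2) (maxN M1 M2) (z i) lam mu (z i.+1).
  exact: (merged_bounce h1 h2 o1 o2 S1S T2S S12 S1_0 T2_0 alpha01).
have simp1 : simple_cycle (mkseq z1 (size Q1)).
  by have := z1E _ id; rewrite map_id => <-.
exists z, m; rewrite HE; split=> //.
(* At step 0 the clock shows [T2 0 = 0]: the second block is at a vertex, the first at time [tau]
   past its own. *)
- rewrite /z /merged /run_p /sched_time /= T20 /S1 T10 sub0r.
  rewrite max_r; last by lra.
  rewrite /z1 /z2 !mod0n subr0 scale0r subr0; congr (_, row_mx _ _).
  have := orbit_p o1 0; rewrite /z1 mod0n modn_small // => ->.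
  by apply/rowP => j; rewrite !mxE /tau; ring.
- exact: (extension_of_bounces hH reg bnc).
- split; first exact: (closed_of_bounces hH m0 zper reg bnc).
  exact: (merged_simple h1 h2 o1 o2 Q1_gt0 S1S T2S S1_per T2_per S12 S1_0 T2_0 alpha01 simp1).
- rewrite (z1E _ (fun x => alpha *: x.1)) (z2E _ (fun x => (1 - alpha) *: x.1)).
  rewrite (z1E _ (fun x => x.2)) (z2E _ (fun x => x.2)).
  exact: (merged_lines o1 o2 Q1_gt0 Q2_gt0 alpha S1S T2S S1_per T2_per S12 S1_0 T2_0).
Qed.
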